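(* For every real $u>1$ and every positive integer $d$ there exists $k>1$, depending only on $u$ and $d$, with the following property. Let $K\neq\{e\}$ be a finitely generated locally indicable group such that every finitely generated subgroup $H$ of $K$ either satisfies $\omega(H)\geq u$, or is isomorphic to $\mathbb{Z}^n$ for some $0\leq n\leq d$, or is isomorphic to the Klein bottle group. Then for any non-proper HNN extension $G=K\rtimes_\alpha\mathbb{Z}$, where $\alpha$ is an automorphism of $K$ having no periodic conjugacy classes, we have $\omega(G)\geq k$.
   Context: For a finitely generated group $G$ and a finite generating set $A$ of $G$, let $\gamma_A(n)$ be the number of elements of $G$ of word length at most $n$ with respect to $A\cup A^{-1}$, and let $\omega(G,A)=\lim_{n\to\infty}\gamma_A(n)^{1/n}$ (the limit exists since $\gamma_A$ is submultiplicative). The growth constant of $G$ is $\omega(G)=\inf_A \omega(G,A)$, the infimum being over all finite generating sets $A$ of $G$. A group is locally indicable if every non-trivial finitely generated subgroup has a surjective homomorphism onto $\mathbb{Z}$. For an automorphism $\alpha$ of $K$, the non-proper HNN extension is $K\rtimes_\alpha\mathbb{Z}=\langle K,t\mid tkt^{-1}=\alpha(k)\ (k\in K)\rangle$. An automorphism $\alpha$ of $K$ has a periodic conjugacy class if there exist a non-identity element $x\in K$ and a non-zero integer $n$ such that $\alpha^n(x)$ is conjugate to $x$ in $K$. The Klein bottle group is $\langle a,b\mid bab^{-1}=a^{-1}\rangle$. *)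

(* Defs.v *)
From HB Require Import structures.
From mathcomp Require Import all_boot all_order all_algebra generic_quotient.
From mathcomp Require Import finmap zify.
From mathcomp Require Import all_classical all_reals all_analysis.

Set Implicit Arguments.
Unset Strict Implicit.
Unset Printing Implicit Defensive.

Import Order.TTheory GRing.Theory Num.Theory.
Import numFieldNormedType.Exports.
Import Algebra.

Local Open Scope classical_set_scope.
Local Open Scope quotient_scope.
Local Open Scope group_scope.

Section Subgroups.
Variable G : groupType.
Implicit Types A H : set G.

Definition subgroup H : Prop := H 1 /\ (forall x y, H x -> H y -> H (x / y)).

Definition generated A : set G := smallest subgroup A.

Definition generating_set H A : Prop := finite_set A /\ generated A = H.

Definition finitely_generated H : Prop := exists A, generating_set H A.

End Subgroups.

(* A subgroup [H] of [G] is a set of elements of [G].  Word length in [H] with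
   respect to a generating set [A] of [H] involves only products of elements of
   [A], so it can be computed in [G]; the growth of the group [G] itself is the
   case [H = [set: G]]. *)
Section Growth.
Variables (R : realType) (G : groupType).
Implicit Types A H : set G.

Definition word_ball A (n : nat) : set G :=
  [set x | exists w : seq G, [/\ (size w <= n)%N,
     (forall y, y \in w -> A y \/ A y^-1) & x = \prod_(y <- w) y]].

(* [fset_set] is meaningful here only for finite balls, that is, finite [A]. *)
Definition growth_function A (n : nat) : nat := #|` fset_set (word_ball A n)|%fset.

Definition growth_rate A : R :=
  limn (fun n : nat => ((growth_function A n)%:R `^ (n%:R)^-1)%R).

Definition growth_constant H : R :=
  inf [set growth_rate A | A in generating_set H].

End Growth.

Section Isomorphisms.
Variable G : groupType.
Implicit Types H : set G.

Definition isomorphic_to (L : groupType) H : Prop := exists f : G -> L,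
  {in H &, {morph f : x y / x * y}} /\ set_bij H [set: L] f.

(* [Z^n] is additive, hence not a [groupType]. *)
Definition isomorphic_to_Zn (n : nat) H : Prop := exists f : G -> 'rV[int]_n,
  {in H &, {morph f : x y / x * y >-> (x + y)%R}} /\
  set_bij H [set: 'rV[int]_n] f.

Definition maps_onto_Z H : Prop := exists f : G -> int,
  {in H &, {morph f : x y / x * y >-> (x + y)%R}} /\ f @` H = [set: int].

End Isomorphisms.

Definition locally_indicable (G : groupType) : Prop :=
  forall H : set G, subgroup H -> finitely_generated H -> H <> [set 1] ->
  maps_onto_Z H.

(* Groups given by a presentation.  A letter [(x, false)] stands for the
   generator [x] and [(x, true)] for its inverse; [rel u v] says that [u = v] is
   one of the defining relations. *)
Section Presentation.
Variable X : choiceType.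
Notation word := (seq (X * bool)).
Variable rel : word -> word -> Prop.

Inductive pres_eq : word -> word -> Prop :=
| pres_rel u v : rel u v -> pres_eq u v
| pres_cancel x b : pres_eq [:: (x, b); (x, ~~ b)] [::]
| pres_cat u u' v v' : pres_eq u u' -> pres_eq v v' ->
    pres_eq (u ++ v) (u' ++ v')
| pres_refl u : pres_eq u u
| pres_sym u v : pres_eq u v -> pres_eq v u
| pres_trans u v w : pres_eq u v -> pres_eq v w -> pres_eq u w.

Definition pres_eqb (u v : word) : bool := `[< pres_eq u v >].

Lemma pres_eqb_equiv : equiv_class_of pres_eqb.
Proof.
split=> [u|u v|v u w].
- by apply/asboolP; exact: pres_refl.
- by apply/asboolP/asboolP; exact: pres_sym.
- by move=> /asboolP uv /asboolP vw; apply/asboolP; exact: pres_trans vw.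
Qed.

Canonical pres_equiv := EquivRelPack pres_eqb_equiv.

Definition presented_group := {eq_quot pres_equiv}.
HB.instance Definition _ := Choice.on presented_group.

Definition word_inv (u : word) : word := rev [seq (c.1, ~~ c.2) | c <- u].

Definition pres_class (u : word) : presented_group :=
  \pi_({eq_quot pres_equiv}) u.
Definition pres_mul (g h : presented_group) : presented_group :=
  pres_class (repr g ++ repr h).
Definition pres_inv (g : presented_group) : presented_group :=
  pres_class (word_inv (repr g)).

Lemma pres_classP u v : pres_class u = pres_class v <-> pres_eq u v.
Proof.
split=> [/eqP|uv]; first by rewrite /pres_class piE /= => /asboolP.
by apply/eqP; rewrite /pres_class piE; apply/asboolP.
Qed.

Lemma pres_reprK g : pres_class (repr g) = g.
Proof. exact: reprK. Qed.

Lemma pres_eq_repr u : pres_eq (repr (pres_class u)) u.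
Proof. by apply/pres_classP; rewrite pres_reprK. Qed.

Lemma word_inv_cat u v : word_inv (u ++ v) = word_inv v ++ word_inv u.
Proof. by rewrite /word_inv map_cat rev_cat. Qed.

Lemma word_invK u : word_inv (word_inv u) = u.
Proof.
rewrite /word_inv map_rev revK -map_comp -[RHS]map_id.
by apply: eq_map => -[x b] /=; rewrite negbK.
Qed.

Lemma pres_eq_mulV u : pres_eq (u ++ word_inv u) [::].
Proof.
elim: u => [|[x b] u IHu]; first exact: pres_refl.
have -> : ((x, b) :: u) ++ word_inv ((x, b) :: u) =
    [:: (x, b)] ++ ((u ++ word_inv u) ++ word_inv [:: (x, b)]).
  by rewrite -(cat1s _ u) word_inv_cat -!catA.
apply: pres_trans (pres_cancel x b).
rewrite -[X in pres_eq _ X]/([:: (x, b)] ++ ([::] ++ word_inv [:: (x, b)])).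
apply: pres_cat; first exact: pres_refl.
by apply: pres_cat IHu _; exact: pres_refl.
Qed.

Lemma pres_mulE u v :
  pres_mul (pres_class u) (pres_class v) = pres_class (u ++ v).
Proof. by apply/pres_classP; apply: pres_cat; exact: pres_eq_repr. Qed.

Lemma pres_mulA : associative pres_mul.
Proof.
move=> f g h; rewrite -[f]pres_reprK -[g]pres_reprK -[h]pres_reprK.
by rewrite !pres_mulE catA.
Qed.

Lemma pres_mul1 : left_id (pres_class [::]) pres_mul.
Proof. by move=> g; rewrite -[g]pres_reprK pres_mulE. Qed.

Lemma pres_1mul : right_id (pres_class [::]) pres_mul.
Proof. by move=> g; rewrite -[g]pres_reprK pres_mulE cats0. Qed.

Lemma pres_mulV : right_inverse (pres_class [::]) pres_inv pres_mul.
Proof.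
move=> g; rewrite -{1}[g]pres_reprK pres_mulE.
by apply/pres_classP; exact: pres_eq_mulV.
Qed.

Lemma pres_Vmul : left_inverse (pres_class [::]) pres_inv pres_mul.
Proof.
move=> g; rewrite -{2}[g]pres_reprK pres_mulE; apply/pres_classP.
by rewrite -{2}[repr g]word_invK; exact: pres_eq_mulV.
Qed.

HB.instance Definition _ := isGroup.Build presented_group
  pres_mulA pres_mul1 pres_1mul pres_Vmul pres_mulV.

End Presentation.

(* The generators are [a = false] and [b = true], so that the relation reads
   [b a b^-1 = a^-1]. *)
Inductive klein_rel : seq (bool * bool) -> seq (bool * bool) -> Prop :=
| KleinRel : klein_rel [:: (true, false); (false, false); (true, true)]
                       [:: (false, true)].

Definition klein_bottle_group := presented_group klein_rel.
HB.instance Definition _ := Group.on klein_bottle_group.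

Record automorphism (K : groupType) := Automorphism {
  aut_fun :> K -> K;
  aut_inv : K -> K;
  autM : {morph aut_fun : x y / x * y};
  autK : cancel aut_fun aut_inv;
  aut_invK : cancel aut_inv aut_fun
}.

Definition aut_exp (K : groupType) (alpha : automorphism K) (n : int) : K -> K :=
  match n with
  | Posz m => iter m alpha
  | Negz m => iter m.+1 (aut_inv alpha)
  end.

Definition has_periodic_conjugacy_class (K : groupType)
    (alpha : automorphism K) : Prop :=
  exists (x : K) (n : int), [/\ x <> 1, n <> 0%R &
    exists y : K, aut_exp alpha n x = x ^ y].

(* The pair [(k, m)] stands for [k t^m], and [t k t^-1 = alpha k].  The argument
   [alpha] of the type selects the group structure. *)
Definition hnn_extension (K : groupType) (alpha : automorphism K) : Type :=
  (K * int)%type.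

Section HNN.
Variables (K : groupType) (alpha : automorphism K).
Local Notation hnn_extension := (hnn_extension alpha).

HB.instance Definition _ := Choice.copy hnn_extension (K * int)%type.

Definition hnn_mul (g h : hnn_extension) : hnn_extension :=
  (g.1 * aut_exp alpha g.2 h.1, (g.2 + h.2)%R).
Definition hnn_one : hnn_extension := (1, 0%R).
Definition hnn_inv (g : hnn_extension) : hnn_extension :=
  (aut_exp alpha (- g.2)%R g.1^-1, (- g.2)%R).

Lemma aut_expS n x : aut_exp alpha (n + 1)%R x = alpha (aut_exp alpha n x).
Proof.
case: n => [n|[|n]]; last 2 first.
- by rewrite /= aut_invK.
- have -> : (Negz n.+1 + 1 = Negz n)%R by lia.
  by rewrite /= aut_invK.
by have -> : (Posz n + 1 = Posz n.+1)%R by lia.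
Qed.

Lemma aut_expD m n x :
  aut_exp alpha (m + n)%R x = aut_exp alpha m (aut_exp alpha n x).
Proof.
have expB k z : aut_exp alpha (k - 1)%R z = aut_inv alpha (aut_exp alpha k z).
  by rewrite -[in RHS](subrK 1%R k) aut_expS autK.
elim: m => [|m IHm|m IHm]; first by rewrite add0r.
  by rewrite intS addrC [(1 + _)%R]addrC addrA !aut_expS addrC IHm.
rewrite intS opprD addrC [(- 1 - _)%R]addrC addrA !expB.
by rewrite [(n - _)%R]addrC IHm.
Qed.

Lemma aut_invM : {morph aut_inv alpha : x y / x * y}.
Proof.
by move=> x y; rewrite -{1}[x](aut_invK alpha) -{1}[y](aut_invK alpha) -autM autK.
Qed.

Lemma aut_expM n : {morph aut_exp alpha n : x y / x * y}.
Proof.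
have iterM (f : K -> K) : {morph f : x y / x * y} ->
    forall k, {morph iter k f : x y / x * y}.
  by move=> fM; elim=> // k IHk x y; rewrite !iterS IHk fM.
by case: n => n; apply: iterM; [exact: autM | exact: aut_invM].
Qed.

Lemma aut_exp1 n : aut_exp alpha n 1 = 1.
Proof. by apply: (mulgI (aut_exp alpha n 1)); rewrite -aut_expM !mulg1. Qed.

Lemma hnn_mulA : associative hnn_mul.
Proof.
by move=> [x m] [y n] [z p]; rewrite /hnn_mul /= aut_expM aut_expD mulgA addrA.
Qed.

Lemma hnn_mul1 : left_id hnn_one hnn_mul.
Proof. by move=> [x m]; rewrite /hnn_mul /= mul1g add0r. Qed.

Lemma hnn_1mul : right_id hnn_one hnn_mul.
Proof. by move=> [x m]; rewrite /hnn_mul /= aut_exp1 mulg1 addr0. Qed.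

Lemma hnn_Vmul : left_inverse hnn_one hnn_inv hnn_mul.
Proof.
move=> [x m]; rewrite /hnn_mul /hnn_inv /= -aut_expM mulVg aut_exp1.
by rewrite addNr.
Qed.

Lemma hnn_mulV : right_inverse hnn_one hnn_inv hnn_mul.
Proof.
by move=> [x m]; rewrite /hnn_mul /hnn_inv /= -aut_expD subrr mulgV.
Qed.

HB.instance Definition _ := isGroup.Build hnn_extension
  hnn_mulA hnn_mul1 hnn_1mul hnn_Vmul hnn_mulV.

Definition hnn_base (k : K) : hnn_extension := (k, 0%R).
Definition hnn_stable : hnn_extension := (1, 1%R).

Lemma hnn_relation k :
  hnn_stable * hnn_base k * hnn_stable^-1 = hnn_base (alpha k).
Proof.
rewrite -[LHS]/(hnn_mul (hnn_mul hnn_stable (hnn_base k)) (hnn_inv hnn_stable)).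
by rewrite /hnn_mul /hnn_inv /hnn_base invg1 !aut_exp1 mul1g mulg1 subrr.
Qed.

End HNN.

(* Main.v *)
Require Import Defs.
From mathcomp Require Import zify ring lra.
From mathcomp Require Import all_boot all_order all_algebra generic_quotient finmap.
From mathcomp Require Import all_field.
From mathcomp Require Import all_classical all_reals all_analysis.

(* Let [t] be a generator of [G] outside [K] and [x] a non-trivial commutator of
   [t] with another generator, so that [x] lies in [K]; write [x_i] for
   [t^i x t^-i].  If a bounded number of the [x_i] generate a subgroup of growth
   at least [u], we are done.  Otherwise, in the abelian and Klein bottle cases
   alike, the squares [z_i] of the [x_i] commute for small [i] and satisfy a
   relation [c], a non-zero integer polynomial that we take of minimal degree.
   If [t^k] and [z t^k] do not generate a free semigroup for any small [k], the
   case [k = 1] shows that the positive orbit of [z] generates a finitely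
   generated subgroup, which local indicability maps non-trivially to [Z].  The
   image of the orbit is a sequence annihilated by [c] and, for each small [k],
   by some [P_k(X^k)] with coefficients in [-1, 0, 1]; these have a common root,
   an algebraic integer whose conjugates [r] satisfy [|r|^k < 2] for all small
   [k].  By Kronecker's theorem it is a root of unity, so that [c] has a
   cyclotomic factor, and the cofactor gives an element of [K] fixed up to
   conjugacy by a power of [alpha]. *)

Set Implicit Arguments.
Unset Strict Implicit.
Unset Printing Implicit Defensive.

Import Order.TTheory GRing.Theory Num.Theory.
Import Algebra.
Import numFieldNormedType.Exports.

Local Open Scope classical_set_scope.
Local Open Scope ring_scope.

(** * Kronecker's theorem and monic factors *)

Lemma pigeonhole_seq (T : eqType) (s : seq T) (f : nat -> T) :
  (forall i, (i <= size s)%N -> f i \in s) ->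
  exists i j, [/\ (i < j)%N, (j <= size s)%N & f i = f j].
Proof.
move=> fs; have : ~~ uniq (mkseq f (size s).+1).
  apply/negP => u; have H := uniq_leq_size u.
  suff /H : {subset mkseq f (size s).+1 <= s} by rewrite size_mkseq ltnn.
  by move=> x /mapP[i]; rewrite mem_iota => /= /fs fi ->.
case/(uniqPn (f 0%N)) => i [j [ij]]; rewrite size_mkseq => js.
by rewrite !nth_mkseq ?(ltn_trans ij js) // => e; exists i, j.
Qed.

(** Up to sign, [F(X) F(-X)] equals [G(X^2)]. The coefficients of [G] are therefore, up to sign, the
    even coefficients of a product of two integral polynomials. *)
Lemma graeffe_int (rs : seq algC) :
  \prod_(r <- rs) ('X - r%:P) \is a polyOver Num.int ->
  \prod_(r <- rs) ('X - (r ^+ 2)%:P) \is a polyOver Num.int.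
Proof.
set F := \prod_(r <- rs) _; set G := \prod_(r <- rs) _ => Fint.
have FG : F * (F \Po - 'X) = (-1) ^+ size rs *: (G \Po 'X^2).
  rewrite /F /G !rmorph_prod /= -big_split /= {Fint F G}.
  elim: rs => [|r rs IH]; first by rewrite !big_nil expr0 scale1r.
  rewrite !big_cons {}IH /= -scalerAr [(-1) ^+ _.+1]exprSr -scalerA.
  congr (_ *: _).
  rewrite scaleN1r -mulNr; congr (_ * _).
  rewrite !rmorphB /= !comp_polyX !comp_polyC -opprD mulrN -subr_sqr.
  by rewrite -rmorphXn.
apply/polyOverP => i.
have -> : G`_i = (-1) ^+ size rs * (F * (F \Po - 'X))`_(2 * i).
  by rewrite FG coefZ signrMK coef_comp_poly_Xn // dvdn_mulr // mulKn.
apply: rpredM; first by rewrite rpredX // rpredN rpred1.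
apply/polyOverP; apply: rpredM => //.
apply: polyOver_comp => //; rewrite rpredN.
exact: polyOverX.
Qed.

Lemma coef_prod_XsubC_le (rs : seq algC) i :
  `|(\prod_(r <- rs) ('X - r%:P))`_i| <= \prod_(r <- rs) (1 + `|r|).
Proof.
elim: rs i => [|r rs IH] i.
  by rewrite !big_nil coef1; case: eqP; rewrite ?normr1 ?normr0.
rewrite !big_cons mulrBl coefB coefXM coefCM mulrDl mul1r.
apply: (le_trans (ler_normB _ _)); apply: lerD.
  case: eqP => _; last exact: IH.
  by rewrite normr0 prodr_ge0 // => ? _; rewrite addr_ge0.
by rewrite normrM ler_wpM2l.
Qed.

(* If all roots are below 2 in absolute value up to the power [l], the iterated
   Graeffe transforms of the polynomial are integral with bounded coefficients,
   so two of them agree and the roots are permuted by a power map. *)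
Lemma kronecker_uniform (N : nat) : exists2 l : nat, (0 < l)%N &
  forall rs : seq algC, (size rs <= N)%N ->
    \prod_(r <- rs) ('X - r%:P) \is a polyOver Num.int ->
    (forall r k, r \in rs -> (0 < k <= l)%N -> `|r| ^+ k < 2) ->
    forall r, r \in rs -> r != 0 -> exists2 m : nat, (0 < m)%N & r ^+ m = 1.
Proof.
(* Roots below 2 in absolute value bound all coefficients by [3 ^ N]. The list [S] holds every
   integral polynomial with coefficients in [[-B, B]] and degree at most [N], each coefficient being
   stored after a shift by [B]. *)
pose B := (3 ^ N)%N.
pose S := [seq \poly_(i < N.+1) ((f (inord i) : nat)%:R - B%:R : algC)
          | f : {ffun 'I_N.+1 -> 'I_(2 * B).+1}].
(* The pigeonhole on [S] uses the transforms [F 0, ..., F (size S)], whose roots are powers with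
   exponent at most this value. *)
exists (2 ^ size S)%N; first by rewrite expn_gt0.
move=> rs sz rs_int rs_lt.
pose F m := \prod_(r <- rs) ('X - (r ^+ (2 ^ m))%:P).
have F_int m : F m \is a polyOver Num.int.
  elim: m => [|m IH]; first by rewrite /F; under eq_bigr do rewrite expn0 expr1.
  move: IH; rewrite /F -(big_map (fun r => r ^+ (2 ^ m)) xpredT
     (fun r => 'X - r%:P)) => /graeffe_int; rewrite big_map.
  by under eq_bigr do rewrite -exprM -expnSr.
have FS m : (m <= size S)%N -> F m \in S.
  move=> mS.
  have Fle i : `|(F m)`_i| <= B%:R.
    have -> : F m = \prod_(r <- [seq r ^+ (2 ^ m) | r <- rs]) ('X - r%:P).
      by rewrite big_map.
    apply: le_trans (coef_prod_XsubC_le _ _) _; rewrite big_map /B natrX.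
    apply: le_trans (_ : (3%:R : algC) ^+ size rs <= _); last first.
      by rewrite ler_weXn2l // ler1n.
    have -> : (3%:R : algC) ^+ size rs = \prod_(r <- rs) 3%:R.
      by rewrite big_const_seq count_predT iter_mulr_1.
    rewrite big_seq [X in _ <= X]big_seq; apply: ler_prod => r rin.
    rewrite addr_ge0 //= -[3%:R]/(1 + 2%:R) lerD2l normrX ltW //.
    by apply: rs_lt => //; rewrite expn_gt0 leq_exp2l.
  apply/mapP; exists [ffun i : 'I_N.+1 => inord (Num.truncn ((F m)`_i + B%:R))].
    by rewrite mem_enum.
  apply/polyP => i; rewrite coef_poly; case: ltnP => iN; last first.
    rewrite nth_default // (leq_trans _ iN) //.
    by rewrite size_prod_XsubC.
  have [n nE] : exists n : nat, (F m)`_i + B%:R = n%:R.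
    apply/natrP; rewrite natrEint rpredD ?(polyOverP (F_int m)) //=.
    by have := Fle i; rewrite real_ler_norml ?Rreal_int ?(polyOverP (F_int m)) //
      => /andP[+ _]; rewrite -[0 <= _]lerBlDr sub0r.
  have iE : (inord i : 'I_N.+1) = i :> nat by rewrite inordK.
  rewrite ffunE iE nE natrK inordK; first by rewrite -nE addrK.
  rewrite ltnS -(ler_nat algC) -nE mul2n -addnn natrD lerD2r.
  by apply: le_trans (Fle i); rewrite real_ler_norm // Rreal_int // (polyOverP (F_int m)).
have [m1 [m2 [m12 _ Fm]]] := pigeonhole_seq FS.
(* Equality of [F m1] and [F m2] means that the powers with exponents [2 ^ m1] and [2 ^ m2] are the
   same roots, so raising to the power [s] maps the finite set [T] to itself. *)
pose T := [seq r ^+ (2 ^ m1) | r <- rs].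
pose s := (2 ^ (m2 - m1))%N.
have s1 : (1 < s)%N by rewrite -{1}(expn0 2) ltn_exp2l // subn_gt0.
have Ts x : x \in T -> x ^+ s \in T.
  case/mapP => r rin ->; rewrite -exprM /s -expnD subnKC ?(ltnW m12) //.
  rewrite -root_prod_XsubC big_map -/(F m1) Fm /F.
  rewrite -(big_map (fun r => r ^+ (2 ^ m2)) xpredT (fun r => 'X - r%:P)).
  by rewrite root_prod_XsubC; apply/mapP; exists r.
move=> r rin r0.
have rT i : (r ^+ (2 ^ m1)) ^+ (s ^ i) \in T.
  elim: i => [|i IH]; first by rewrite expr1; apply/mapP; exists r.
  by rewrite expnSr exprM Ts.
have [i [j [ij _ e]]] := @pigeonhole_seq _ T _ (fun i _ => rT i).
exists (2 ^ m1 * (s ^ j - s ^ i))%N.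
  by rewrite muln_gt0 expn_gt0 subn_gt0 ltn_exp2l.
have nz : r ^+ (2 ^ m1) != 0 by rewrite expf_neq0.
rewrite exprM expfB ?ltn_exp2l // e divff // expf_neq0 //.
Qed.

(** Descent on the degree of [c]: if a root [x] of [c] is not a root of some [p] in [I], then [c]
    divided by ['X - x%:P] is again in [I]. The descent cannot reach a constant, which would put 1
    in [I]. *)
Lemma ideal_common_root (C : closedFieldType) (I : {poly C} -> Prop)
    (c : {poly C}) :
  (forall p q, I p -> I q -> I (p + q)) -> (forall p q, I p -> I (p * q)) ->
  ~ I 1 -> c != 0 -> I c -> exists x, forall p, I p -> root p x.
Proof.
move=> ID IM I1; have [n] := ubnP (size c); elim: n c => // n IH c szc c0 Ic.
have /closed_rootP[x] : size c != 1%N.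
  apply/eqP => /eqP/size_poly1P[b b0 cE]; apply: I1.
  suff -> : 1 = c * (b^-1)%:P by exact: IM.
  by rewrite cE -polyCM divff.
move=> cx; have [|/existsNP[p /not_implyP[Ip px]]] :=
  pselect (forall p, I p -> root p x); first by exists x.
have /factor_theorem[q cE] := cx.
have /factor_theorem[p' pE] : root (p - p.[x]%:P) x.
  by rewrite rootE !hornerE subrr.
have q0 : q != 0 by apply: contraNneq c0; rewrite cE => ->; rewrite mul0r.
apply: (IH q) => //.
  by move: szc; rewrite cE size_Mmonic ?monicXsubC // size_XsubC addn2 /=.
have -> : q = (p * q + c * - p') * (p.[x]^-1)%:P.
  have -> : p * q + c * - p' = p.[x]%:P * q.
    have {1}-> : p = p' * ('X - x%:P) + p.[x]%:P by rewrite -pE subrK.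
    by rewrite cE; ring.
  by rewrite mulrAC -polyCM divff ?mul1r //; apply/negP => /px.
by apply/IM/ID; apply: IM.
Qed.

(** The polynomial [p] in the shift operator, applied to [a] and read at [s]. It vanishes for all
    [s] when [a] satisfies the linear recurrence with characteristic polynomial [p]. *)
Definition shift_sum (R : nzRingType) (a : nat -> R) (p : {poly R}) (s : nat) : R :=
  \sum_(i < size p) p`_i * a (i + s)%N.

Section ShiftSum.
Variables (R : nzRingType) (a : nat -> R).
Implicit Types p q : {poly R}.

Lemma shift_sum_widen p n s : (size p <= n)%N ->
  shift_sum a p s = \sum_(i < n) p`_i * a (i + s)%N.
Proof.
move=> pn; rewrite /shift_sum (big_ord_widen n (fun i => p`_i * a (i + s)%N) pn).
rewrite big_mkcond; apply: eq_bigr => i _; case: ltnP => // pi.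
by rewrite nth_default // mul0r.
Qed.

Lemma shift_sum0 s : shift_sum a 0 s = 0.
Proof. by rewrite /shift_sum size_poly0 big_ord0. Qed.

Lemma shift_sumD p q s :
  shift_sum a (p + q) s = shift_sum a p s + shift_sum a q s.
Proof.
pose n := maxn (size p) (size q).
rewrite !(@shift_sum_widen _ n) ?leq_maxl ?leq_maxr ?size_polyD //.
by rewrite -big_split; apply: eq_bigr => i _; rewrite coefD mulrDl.
Qed.

Lemma shift_sumZ k p s : shift_sum a (k *: p) s = k * shift_sum a p s.
Proof.
rewrite (@shift_sum_widen _ (size p)) ?size_scale_leq // mulr_sumr.
by apply: eq_bigr => i _; rewrite coefZ mulrA.
Qed.

Lemma shift_sumMX p s : shift_sum a (p * 'X) s = shift_sum a p s.+1.
Proof.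
rewrite (@shift_sum_widen _ (size p).+1); last first.
  by rewrite (leq_trans (size_polyMleq _ _)) // size_polyX addn2.
rewrite big_ord_recl coefMX mul0r add0r; apply: eq_bigr => i _.
by rewrite coefMX /= addSnnS.
Qed.

Lemma shift_sumXn n s : shift_sum a 'X^n s = a (n + s)%N.
Proof.
elim: n s => [|n IH] s; last by rewrite exprSr shift_sumMX IH addSnnS.
by rewrite /shift_sum size_poly1 big_ord1 coef1 mul1r.
Qed.

End ShiftSum.

(** With [shift_sumD], this makes the polynomials annihilating [a] an ideal. *)
Lemma shift_sumM (R : comNzRingType) (a : nat -> R) (p q : {poly R}) :
  (forall s, shift_sum a p s = 0) -> forall s, shift_sum a (p * q) s = 0.
Proof.
move=> p0; elim/poly_ind: q => [|q c IH] s; first by rewrite mulr0 shift_sum0.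
rewrite mulrDr shift_sumD mulrA shift_sumMX IH add0r mulrC mul_polyC.
by rewrite shift_sumZ p0 mulr0.
Qed.

Lemma shift_sum_comp_Xn (R : comNzRingType) (a : nat -> R) (p : {poly R}) k s :
  shift_sum a (p \Po 'X^k) s = \sum_(i < size p) p`_i * a (i * k + s)%N.
Proof.
rewrite comp_polyE.
rewrite (big_morph (shift_sum a ^~ s) (id1 := 0) (op1 := +%R)); first last.
- exact: shift_sum0.
- by move=> x y; rewrite shift_sumD.
apply: eq_bigr => i _; rewrite shift_sumZ -exprM shift_sumXn.
by rewrite mulnC.
Qed.

Lemma shift_sum_intr (R : nzRingType) (a : nat -> int) (p : {poly int}) s :
  shift_sum (fun i => (a i)%:~R) (map_poly intr p) s = (shift_sum a p s)%:~R :> R.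
Proof.
rewrite (@shift_sum_widen _ _ _ (size p)); last exact: size_poly.
rewrite rmorph_sum; apply: eq_bigr => i _.
by rewrite coef_map /= intrM.
Qed.

(** If [|x|] were at least 2, then [|x| ^+ n] would exceed the sum of all lower powers by at least
    1, and the leading term, whose coefficient is a non-zero integer, could not be cancelled. *)
Lemma sign_poly_root_lt2 (P : {poly int}) (x : algC) : P != 0 ->
  (forall i, `|P`_i| <= 1) -> root (map_poly intr P) x -> `|x| < 2.
Proof.
move=> P0 P1 /rootP; rewrite horner_coef size_map_inj_poly //; last first.
  exact: intr_inj.
have : (0 < size P)%N by rewrite size_poly_gt0.
case sz : (size P) => [//|n] _; rewrite big_ord_recr /= => /eqP.
rewrite addrC addr_eq0 => /eqP e.
have lead : 1 <= `|(map_poly intr P)`_n : algC|.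
  rewrite coef_map /= -intr_norm -[1]/(1%:~R) ler_int -gtz0_ge1 normr_gt0.
  by have := P0; rewrite -lead_coef_eq0 lead_coefE sz.
rewrite real_ltNge ?realn //; apply/negP => x2.
have x1 : 1 <= `|x| by apply: le_trans x2; rewrite ler1n.
have sumle : forall m, (\sum_(i < m) `|x| ^+ i) + 1 <= `|x| ^+ m.
  elim=> [|m IH]; first by rewrite big_ord0 add0r.
  rewrite big_ord_recr /= addrAC exprS; apply: le_trans (_ : 2 * `|x| ^+ m <= _).
    by rewrite mulr_natl mulr2n lerD2r.
  by rewrite ler_wpM2r ?exprn_ge0.
have := congr1 Num.norm e; rewrite normrN normrM normrX => ee.
have : `|x| ^+ n <= \sum_(i < n) `|x| ^+ i.
  apply: le_trans (_ : `|(map_poly intr P)`_n : algC| * `|x| ^+ n <= _).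
    by rewrite ler_peMl ?exprn_ge0.
  rewrite ee; apply: (le_trans (ler_norm_sum _ _ _)); apply: ler_sum => i _.
  rewrite normrM normrX coef_map /= -intr_norm ler_piMl ?exprn_ge0 //.
  by rewrite -[1]/(1%:~R) ler_int.
move=> /(le_trans (sumle n)); rewrite gerDl.
by rewrite ler10.
Qed.

(** * Minimal polynomials over the integers and cyclotomic factors *)

Lemma size_intr_poly (p : {poly int}) :
  size (map_poly intr p : {poly algC}) = size p.
Proof. by rewrite size_map_inj_poly //; exact: intr_inj. Qed.

Lemma minCpoly_dvd_int (x : algC) (q : {poly int}) :
  root (map_poly intr q) x -> exists h, map_poly intr q = h * minCpoly x.
Proof.
have [p [-> _] pP] := minCpolyP x.
have qE : map_poly intr q = map_poly ratr (map_poly intr q) :> {poly algC}.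
  by rewrite -map_poly_comp; apply: eq_map_poly => n /=; rewrite ratr_int.
rewrite qE pP => /dvdpP[h ->]; exists (map_poly ratr h).
by rewrite rmorphM.
Qed.

(** Division by the monic [f] stays inside the integral polynomials. The remainder vanishes at [x]
    and is shorter than the minimal polynomial, hence is zero. *)
Lemma minpoly_int_dvd (x : algC) (f q : {poly int}) :
  minCpoly x = map_poly intr f -> root (map_poly intr q) x ->
  exists h, q = h * f.
Proof.
move=> fx qx.
have fm : f \is monic.
  apply/monicP/(@intr_inj algC); rewrite -lead_coef_map_inj //; last exact: intr_inj.
  by rewrite -fx (monicP (minCpoly_monic x)).
have qE := Pdiv.RingMonic.rdivp_eq fm q.
exists (Pdiv.Ring.rdivp q f).
suff r0 : Pdiv.Ring.rmodp q f = 0 by rewrite {1}qE r0 addr0.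
set r := Pdiv.Ring.rmodp q f.
have rx : root (map_poly intr r) x.
  have -> : r = q - Pdiv.Ring.rdivp q f * f.
    by apply/eqP; rewrite eq_sym subr_eq addrC; apply/eqP.
  rewrite rmorphB rmorphM /= -fx rootE !hornerE (rootP qx).
  by rewrite (rootP (root_minCpoly x)) mulr0 subrr.
have [h hE] := minCpoly_dvd_int rx.
apply/eqP; apply: contraT => r0.
have inj : injective (intr : int -> algC) by exact: intr_inj.
have : (size r < size f)%N.
  by rewrite Pdiv.Ring.ltn_rmodp monic_neq0.
rewrite -(size_intr_poly r) -(size_intr_poly f) hE -fx.
have h0 : h != 0.
  apply: contra_neq r0 => h0; move: hE; rewrite h0 mul0r => e.
  by apply: (map_inj_poly inj) => //; rewrite e rmorph0.
rewrite size_Mmonic ?minCpoly_monic //.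
have : (0 < size h)%N by rewrite size_poly_gt0.
case: (size h) => // n _; rewrite addSn /= ltnNge leq_addl //.
Qed.

(** The annihilators of [a] over [algC] form an ideal, proper because [a] is not identically zero.
    Kronecker's theorem is applied to a common root [x] of it, and [f] is the minimal polynomial of
    [x]. *)
Lemma cyclotomic_factor (N : nat) : exists2 l : nat, (0 < l)%N &
  forall (a : nat -> int) (c : {poly int}), (exists i, a i != 0) ->
    (size c <= N.+1)%N -> c`_0 != 0 -> (forall s, shift_sum a c s = 0) ->
    (forall k, (0 < k <= l)%N -> exists P : {poly int},
      [/\ P != 0, forall i, `|P`_i| <= 1 &
          forall s, shift_sum a (P \Po 'X^k) s = 0]) ->
  exists (f g h : {poly int}) (m : nat),
    [/\ f \is monic, (1 < size f)%N, (0 < m)%N, c = g * f & 'X^m - 1 = h * f].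
Proof.
have [l l0 kron] := kronecker_uniform N; exists l => //.
move=> a c [i0 ai0] szc c0 ca Pk.
have inj : injective (intr : int -> algC) by exact: intr_inj.
pose b i : algC := (a i)%:~R.
pose I (p : {poly algC}) := forall s, shift_sum b p s = 0.
have cN0 : c != 0 by apply: contra_neq c0 => ->; rewrite coef0.
have toI p : (forall s, shift_sum a p s = 0) -> I (map_poly intr p).
  by move=> pa s; rewrite shift_sum_intr // pa.
have [x xI] : exists x, forall p, I p -> root p x.
  apply: (@ideal_common_root _ _ (map_poly intr c)).
  - by move=> p q Ip Iq s; rewrite shift_sumD Ip Iq addr0.
  - by move=> p q Ip; exact: shift_sumM.
  - move=> /(_ i0)/eqP; rewrite -(expr0 'X) shift_sumXn intr_eq0.
    exact/negP.
  - by rewrite map_poly_eq0_id0 // intr_eq0 lead_coef_eq0.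
  - exact: toI.
have cx : root (map_poly intr c) x by exact/xI/toI.
have x0 : x != 0.
  apply: contra_neq c0 => x0; apply: inj; move: cx; rewrite x0 rootE.
  by rewrite horner_coef0 coef_map /= => /eqP.
have Pk' k : (0 < k <= l)%N -> exists P : {poly int},
    [/\ P != 0, forall i, `|P`_i| <= 1 &
     root (map_poly intr (P \Po 'X^k)) x].
  by move=> /Pk[P [P0 P1 PI]]; exists P; split=> //; exact/xI/toI.
(* The relation for [k = 1] has leading coefficient 1 or -1, so it is monic up to sign. *)
have xint : x \in Aint.
  have [P [P0 P1]] : exists P : {poly int},
    [/\ P != 0, forall i, `|P`_i| <= 1 & root (map_poly intr (P \Po 'X^1)) x].
    by apply: Pk'; rewrite l0.
  rewrite comp_polyXr => Px.
  have lP : lead_coef P * lead_coef P = 1.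
    have : lead_coef P != 0 by rewrite lead_coef_eq0.
    have := P1 (size P).-1; rewrite -lead_coefE.
    case: (lead_coef P) => [[|[|n]]|[|n]] //.
  apply: (@root_monic_Aint (map_poly intr (lead_coef P *: P))).
  - by rewrite map_polyZ rootE hornerZ (rootP Px) mulr0.
  - by rewrite monicE lead_coef_map_inj // lead_coefZ lP.
  - by apply/polyOverP => i; rewrite coef_map /= rpred_int.
have [f fE] := floorpP (xint : minCpoly x \is a polyOver Num.int).
have fm : f \is monic.
  apply/monicP/inj; rewrite -lead_coef_map_inj //.
  by rewrite -fE (monicP (minCpoly_monic x)).
have [g cE] := minpoly_int_dvd fE cx.
have [rs rsE] := closed_field_poly_normal (minCpoly x).
rewrite (monicP (minCpoly_monic x)) scale1r in rsE.
have szf : (1 < size f)%N by rewrite -size_intr_poly -fE size_minCpoly.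
(* The conjugates of [x] number at most [N] because [f] divides [c]; this is what lets [l] depend on
   [N] only. *)
have szrs : (size rs <= N)%N.
  have <- : (size f).-1 = size rs.
    by rewrite -size_intr_poly -fE rsE size_prod_XsubC.
  rewrite -ltnS prednK ?(ltnW szf) // (leq_trans _ szc) // cE.
  have g0 : g != 0 by apply: contra_neq cN0 => g0; rewrite cE g0 mul0r.
  rewrite size_Mmonic //; move: g0; rewrite -size_poly_gt0.
  by case: (size g) => // n _; rewrite addSn /= leq_addl.
have xrs : x \in rs by rewrite -root_prod_XsubC -rsE root_minCpoly.
have [||m m0 xm] := kron rs szrs _ _ x xrs x0.
- by rewrite -rsE.
(* A conjugate [r] of [x] is also a root of [P \Po 'X^k], so [r ^+ k] is a root of [P]. *)
- move=> r k rrs kl; have [P [P0 P1 Px]] := Pk' k kl.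
  have [h hE] := minCpoly_dvd_int Px.
  have rr : root (map_poly intr (P \Po 'X^k)) r.
    by rewrite hE rootM rsE root_prod_XsubC rrs orbT.
  rewrite -normrX; apply: (sign_poly_root_lt2 P0 P1).
  move: rr; rewrite map_comp_poly map_polyXn !rootE horner_comp.
  by rewrite hornerXn.
have [h hE] : exists h, 'X^m - 1 = h * f.
  apply: (minpoly_int_dvd fE); rewrite rmorphB /= map_polyXn rmorph1.
  by rewrite rootE !hornerE xm subrr.
by exists f, g, h, m.
Qed.

(** * Submultiplicative sequences *)

Section Fekete.
Variables (R : realType) (gamma : nat -> nat).
Hypothesis gamma_gt0 : forall n, (0 < gamma n)%N.
Hypothesis gammaD : forall m n, (gamma (m + n) <= gamma m * gamma n)%N.
Local Notation u := (fun n : nat => ((gamma n)%:R `^ (n%:R)^-1 : R)).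

Lemma powR_expK (y : R) n : 0 <= y -> (0 < n)%N -> (y ^+ n) `^ (n%:R)^-1 = y.
Proof.
move=> y0 n0; rewrite -powR_mulrn // -powRrM divff ?powRr1 //.
by rewrite pnatr_eq0 -lt0n.
Qed.

Lemma powR_invK (y : R) n : 0 <= y -> (0 < n)%N -> (y `^ (n%:R)^-1) ^+ n = y.
Proof.
move=> y0 n0; rewrite -powR_mulrn ?powR_ge0 // -powRrM mulVf ?powRr1 //.
by rewrite pnatr_eq0 -lt0n.
Qed.

Lemma root_le (x y : R) n : 0 <= x -> 0 <= y -> (0 < n)%N -> x <= y ^+ n ->
  x `^ (n%:R)^-1 <= y.
Proof.
move=> x0 y0 n0 xy; rewrite -[leRHS](powR_expK y0 n0).
by apply: ge0_ler_powR; rewrite ?invr_ge0 ?nnegrE ?exprn_ge0.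
Qed.

Lemma le_root (x y : R) n : 0 <= x -> 0 <= y -> (0 < n)%N -> y ^+ n <= x ->
  y <= x `^ (n%:R)^-1.
Proof.
move=> x0 y0 n0 xy; rewrite -[leLHS](powR_expK y0 n0).
by apply: ge0_ler_powR; rewrite ?invr_ge0 ?nnegrE ?exprn_ge0.
Qed.

Lemma gamma_mulD q n r : (gamma (q * n + r) <= gamma n ^ q * gamma r)%N.
Proof.
elim: q => [|q IH]; first by rewrite mul0n expn0 mul1n.
by rewrite mulSn -addnA (leq_trans (gammaD _ _)) // expnS -mulnA leq_mul2l IH orbT.
Qed.

Lemma bernoulli (x : R) n : 0 <= x -> 1 + n%:R * x <= (1 + x) ^+ n.
Proof.
move=> x0; elim: n => [|n IH]; first by rewrite mul0r addr0 expr0.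
rewrite exprS; apply: le_trans (_ : (1 + x) * (1 + n%:R * x) <= _); last first.
  by rewrite ler_wpM2l // addr_ge0.
have : 0 <= n%:R * x * x by rewrite !mulr_ge0.
rewrite -natr1; lra.
Qed.

(** Fekete's argument: the limit is the infimum of the [u n]. For [n0] with [u n0] close to it,
    division of [n] by [n0] bounds [gamma n] by a power of [gamma n0] times a constant, whose [n]-th
    root tends to 1. *)
Lemma fekete_cvg : exists rho : R,
  u @ \oo --> rho /\ (forall n, (0 < n)%N -> rho <= u n).
Proof.
pose E := [set u n | n in [set n | (0 < n)%N]].
have u1 n : (0 < n)%N -> 1 <= u n.
  by move=> n0; apply: le_root => //; rewrite expr1n ler1n.
have hasE : has_inf E.
  by split; [exists (u 1%N), 1%N | exists 1 => _ [n n0 <-]; exact: u1].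
have rhole n : (0 < n)%N -> inf E <= u n.
  by move=> n0; apply: ge_inf; [case: hasE | exists n].
exists (inf E); split => //; apply/cvgrPdist_le => e e0.
have rho1 : 1 <= inf E.
  by apply: lb_le_inf; [case: hasE | move=> _ [n n0 <-]; exact: u1].
have e20 : 0 < e / 2 by rewrite divr_gt0.
have [_ [n0 n00 <-] wlt] := inf_adherent e20 hasE.
set w := u n0 in wlt; have w1 : 1 <= w by exact: u1.
have w0 : 0 < w by apply: lt_le_trans w1.
(* Chosen so that [w * (1 + del)] is [w + e / 2], which is below [inf E + e]. *)
pose del := e / 2 / w; have del0 : 0 < del by rewrite divr_gt0.
pose C := (\prod_(r < n0) gamma r)%N.
near=> n.
have n_gt0 : (0 < n)%N by near: n; exact: nbhs_infty_gt.
rewrite ler0_norm ?subr_le0 ?rhole // opprB lerBlDl.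
apply: le_trans (_ : w * (1 + del) <= _); last first.
  rewrite mulrDr mulr1 /del mulrCA divff ?gt_eqF // mulr1.
  by move: wlt; lra.
apply: root_le => //; first by rewrite mulr_ge0 ?addr_ge0 // ltW.
have r_lt : (n %% n0 < n0)%N by rewrite ltn_mod.
have Cr : (gamma (n %% n0) <= C)%N.
  rewrite /C (bigD1 (Ordinal r_lt)) //= leq_pmulr //.
  by rewrite prodn_gt0.
apply: le_trans (_ : (gamma n0 ^ (n %/ n0) * C)%:R <= _).
  rewrite ler_nat {1}(divn_eq n n0) (leq_trans (gamma_mulD _ _ _)) //.
  by rewrite leq_mul2l Cr orbT.
rewrite natrM natrX exprMn ler_pM ?exprn_ge0 //.
  rewrite -[(gamma n0)%:R](@powR_invK _ n0) // -exprM.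
  by rewrite ler_weXn2l // {2}(divn_eq n n0) mulnC leq_addr.
(* Once [n] is at least [C / del], Bernoulli's inequality absorbs the constant [C] into
   [(1 + del) ^+ n]. *)
apply: le_trans (bernoulli n (ltW del0)); apply: le_trans (_ : n%:R * del <= _).
  rewrite -ler_pdivrMr //; near: n; exact: nbhs_infty_ger.
by rewrite lerDr.
Unshelve. all: by end_near. Qed.

Lemma fekete_ub n : (0 < n)%N -> (limn u) ^+ n <= (gamma n)%:R.
Proof.
move=> n0; have [rho [urho rhole]] := fekete_cvg.
rewrite (cvg_lim _ urho) //.
have rho0 : 0 <= rho.
  rewrite -(cvg_lim _ urho) //; apply: limr_ge; first by apply/cvg_ex; exists rho.
  by near=> k; exact: powR_ge0.
rewrite -[leRHS](@powR_invK _ n) // lerXn2r ?nnegrE ?powR_ge0 //.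
exact: rhole.
Unshelve. all: by end_near. Qed.

(** Since [gamma (q * n)] is at most [gamma n ^ q], a bound along the multiples of [q] yields one
    for every [n], at the cost of a [q]-th root. *)
Lemma fekete_lb (v : R) q : (0 < q)%N -> 0 <= v ->
  (forall n, (0 < n)%N -> v ^+ n <= (gamma (q * n))%:R) ->
  v `^ (q%:R)^-1 <= limn u.
Proof.
move=> q0 v0 vle; have [rho [urho _]] := fekete_cvg.
apply: limr_ge; first by apply/cvg_ex; exists rho.
near=> n.
have n0 : (0 < n)%N by near: n; exact: nbhs_infty_gt.
apply: le_root => //; rewrite ?powR_ge0 //.
rewrite -powR_mulrn ?powR_ge0 // -powRrM mulrC powRrM powR_mulrn //.
apply: root_le => //; first by rewrite exprn_ge0.
apply: le_trans (vle n n0) _; rewrite -natrX ler_nat.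
case: (q) q0 => // k _; rewrite mulSnr expnSr.
exact: gamma_mulD.
Unshelve. all: by end_near. Qed.

End Fekete.

Local Close Scope ring_scope.
Local Open Scope group_scope.

(** * Orbits under an injective endomorphism *)

Section Subgroup.
Variable G : groupType.
Implicit Types (A H : set G) (x y : G).

Lemma subgroupV H x : subgroup H -> H x -> H x^-1.
Proof. by move=> [H1 HD] Hx; rewrite -[_^-1]mul1g; exact: HD. Qed.

Lemma subgroupM H x y : subgroup H -> H x -> H y -> H (x * y).
Proof.
by move=> sH Hx Hy; rewrite -[y]invgK; apply: sH.2 => //; exact: subgroupV.
Qed.

Lemma generated_subgroup A : subgroup (generated A).
Proof.
split=> [H [[H1 _] _]//|x y gx gy H HA].
by case: (HA) => -[H1 HD] _; apply: HD; [exact: gx | exact: gy].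
Qed.

Lemma sub_generated A : A `<=` generated A.
Proof. by move=> x Ax H [_]; exact. Qed.

Lemma generated_min A H : subgroup H -> A `<=` H -> generated A `<=` H.
Proof. by move=> sH AH x; apply. Qed.

Lemma generated_commute A :
  (forall x y, A x -> A y -> commute x y) ->
  forall x y, generated A x -> generated A y -> commute x y.
Proof.
move=> Ac.
have sC (B : set G) : subgroup [set x | forall y, B y -> commute x y].
  split=> /= [y _|x y Cx Cy w Bw]; first exact/commute_sym/commute1.
  apply/commute_sym/commuteM; first exact/commute_sym/Cx.
  exact/commuteV/commute_sym/Cy.
have gA : generated A `<=` [set x | forall y, A y -> commute x y].
  by apply: generated_min => // x Ax y Ay; exact: Ac.
have : generated A `<=` [set x | forall y, generated A y -> commute x y].
  by apply: generated_min => // x Ax y gy; apply/commute_sym/gA.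
by move=> H x y gx gy; exact: H.
Qed.

Lemma morph_generated (L : groupType) (f : G -> L) A (H : set L) :
  {morph f : x y / x * y} -> subgroup H -> (forall x, A x -> H (f x)) ->
  forall x, generated A x -> H (f x).
Proof.
move=> fM sH fA; apply: (@generated_min A [set x | H (f x)]) => //.
have f1 : f 1 = 1 by apply: (mulgI (f 1)); rewrite -fM !mulg1.
have fV x : f x^-1 = (f x)^-1 by apply/esym/mulg1_eq; rewrite -fM mulgV.
split=> /= [|x y Hx Hy]; first by rewrite f1; exact: sH.1.
by rewrite fM fV; exact: sH.2.
Qed.

End Subgroup.

Section IntegerPower.
Variable G : groupType.
Implicit Types x y : G.

Definition expgz x (n : int) : G :=
  match n with Posz k => x ^+ k | Negz k => x ^- k.+1 end.

Lemma expgzS x n : expgz x (n + 1)%R = expgz x n * x.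
Proof.
case: n => [n|[|n]].
- have -> : (Posz n + 1 = Posz n.+1)%R by lia.
  by rewrite /= expgSr.
- by rewrite /= mulVg.
have -> : (Negz n.+1 + 1 = Negz n)%R by lia.
by rewrite /= [x ^+ n.+2]expgS invgM mulgVK.
Qed.

(** Identities between integer powers are obtained below by recognising both sides as homomorphisms
    from the integers with the same value at 1. *)
Lemma expgz_hom (F : int -> G) :
  (forall m n, F (m + n)%R = F m * F n) -> forall n, F n = expgz (F 1%R) n.
Proof.
move=> FD.
have FS n : F (n + 1)%R = F n * F 1%R by [].
elim=> [|n IH|n IH].
- by apply: (mulgI (F 0)); rewrite -FD addr0 mulg1.
- have -> : (n.+1%:Z = n%:Z + 1)%R by lia.
  by rewrite FS IH expgzS.
apply: (mulIg (F 1%R)); rewrite -FS -expgzS.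
by have -> : (- n.+1%:Z + 1 = - n%:Z)%R by lia.
Qed.

Lemma expgzD x m n : expgz x (m + n)%R = expgz x m * expgz x n.
Proof.
have D1 k : expgz x (k - 1)%R = expgz x k / x.
  by rewrite -[in RHS](subrK 1%R k) expgzS mulgK.
elim: n => [|n IH|n IH].
- by rewrite addr0 mulg1.
- have -> : (m + n.+1%:Z = m + n%:Z + 1)%R by lia.
  have -> : (n.+1%:Z = n%:Z + 1)%R by lia.
  by rewrite !expgzS IH mulgA.
have -> : (m - n.+1%:Z = m - n%:Z - 1)%R by lia.
have -> : (- n.+1%:Z = - n%:Z - 1)%R by lia.
by rewrite !D1 IH mulgA.
Qed.

Lemma commute_expgz x y n : commute x y -> commute x (expgz y n).
Proof.
by case: n => n xy /=; [exact: commuteX | exact/commuteV/commuteX].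
Qed.

Lemma subgroup_expgz (H : set G) x n : subgroup H -> H x -> H (expgz x n).
Proof.
move=> sH Hx; have HX k : H (x ^+ k).
  by elim: k => [|k IH]; [exact: sH.1 | rewrite expgS; exact: subgroupM].
by case: n => n /=; [exact: HX | apply: subgroupV].
Qed.

End IntegerPower.

Section Ev.
Variable G : groupType.
Implicit Types (f : nat -> G) (p q : {poly int}).

(* The action of [Z[X]] on a sequence in which [X] is the shift. *)
Definition poly_prod f p : G := \prod_(i < size p) expgz (f i) p`_i.

Lemma poly_prod_widen f p n : (size p <= n)%N ->
  poly_prod f p = \prod_(i < n) expgz (f i) p`_i.
Proof.
move=> /subnKC <-; elim: (n - size p)%N => [|k IH]; first by rewrite addn0.
rewrite addnS big_ord_recr /= -IH nth_default ?mulg1 //.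
by rewrite leq_addr.
Qed.

Lemma poly_prodXn f n : poly_prod f 'X^n = f n.
Proof.
rewrite (@poly_prod_widen _ _ n.+1) ?size_polyXn // big_ord_recr /=.
rewrite coefXn eqxx big1 => [|i _]; first by rewrite mul1g.
by rewrite coefXn ltn_eqF.
Qed.

Lemma poly_prod1 f : poly_prod f 1 = f 0%N.
Proof. by rewrite -(expr0 'X) poly_prodXn. Qed.

Lemma poly_prodMX f p : poly_prod f (p * 'X) = poly_prod (f \o S) p.
Proof.
rewrite (@poly_prod_widen _ _ (size p).+1); last first.
  by rewrite (leq_trans (size_polyMleq _ _)) // size_polyX addn2.
by rewrite big_ord_recl coefMX mul1g; apply: eq_bigr => i _; rewrite coefMX.
Qed.

Lemma subgroup_poly_prod (H : set G) f p : subgroup H ->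
  (forall i, (i < size p)%N -> H (f i)) -> H (poly_prod f p).
Proof.
move=> sH Hf; rewrite /poly_prod; elim/big_ind: _ => [|x y Hx Hy|i _].
- exact: sH.1.
- exact: subgroupM.
- by apply: subgroup_expgz => //; exact: Hf.
Qed.

Section Commute.
Variables (f : nat -> G) (n : nat).
Hypothesis fC : forall i j, (i < n)%N -> (j < n)%N -> commute (f i) (f j).

Lemma poly_prod_commute p q : (size p <= n)%N -> (size q <= n)%N ->
  commute (poly_prod f p) (poly_prod f q).
Proof.
move=> pn qn; apply: (@generated_commute _ [set f i | i in [set i | (i < n)%N]]).
- by move=> _ _ [i iN <-] [j jn <-]; exact: fC.
- apply: subgroup_poly_prod => [|i ip]; first exact: generated_subgroup.
  by apply: sub_generated; exists i => //=; exact: leq_trans pn.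
- apply: subgroup_poly_prod => [|i ip]; first exact: generated_subgroup.
  by apply: sub_generated; exists i => //=; exact: leq_trans qn.
Qed.

Lemma poly_prodD p q : (size p <= n)%N -> (size q <= n)%N ->
  poly_prod f (p + q) = poly_prod f p * poly_prod f q.
Proof.
move=> pn qn; rewrite !(@poly_prod_widen _ _ n) //; last first.
  by rewrite (leq_trans (size_polyD _ _)) // geq_max pn.
suff: forall m, (m <= n)%N -> \prod_(i < m) expgz (f i) (p + q)%R`_i =
    \prod_(i < m) expgz (f i) p`_i * \prod_(i < m) expgz (f i) q`_i by exact.
elim=> [_|m IH mn]; first by rewrite !big_ord0 mulg1.
rewrite !big_ord_recr /= IH ?(ltnW mn) // coefD expgzD -!mulgA; congr (_ * _).
rewrite !mulgA; congr (_ * _); apply/esym.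
apply: commute_prod => i _; apply/commute_expgz/commute_sym/commute_expgz.
by apply: fC => //; exact: leq_trans (ltn_ord i) (ltnW mn).
Qed.

Lemma poly_prodZ k p : (size p <= n)%N ->
  poly_prod f (k *: p)%R = expgz (poly_prod f p) k.
Proof.
move=> pn; have sz m : (size (m *: p)%R <= n)%N.
  exact: leq_trans (size_scale_leq _ _) pn.
have := @expgz_hom _ (fun m => poly_prod f (m *: p)%R) => /(_ _ k).
by rewrite scale1r; apply => a b; rewrite scalerDl poly_prodD.
Qed.

End Commute.
End Ev.

(** * Homomorphisms from a subgroup to the integers *)

Section SetHomomorphism.
Variables (G : groupType) (H : set G) (phi : G -> int).
Hypotheses (sH : subgroup H).
Hypothesis phiM : forall x y, H x -> H y -> phi (x * y) = (phi x + phi y)%R.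

Lemma hom_set1 : phi 1 = 0%R.
Proof.
by apply: (addrI (phi 1)); rewrite -phiM ?mulg1 ?addr0 //; exact: sH.1.
Qed.

Lemma hom_set_expgz x n : H x -> phi (expgz x n) = (n * phi x)%R.
Proof.
move=> Hx; have HX k : H (expgz x k) by exact: subgroup_expgz.
have PS k : phi (expgz x (k + 1)%R) = (phi (expgz x k) + phi x)%R.
  by rewrite expgzS phiM.
elim: n => [|n IH|n IH]; first by rewrite mul0r hom_set1.
  have -> : (n.+1%:Z = n%:Z + 1)%R by lia.
  by rewrite PS IH mulrDl mul1r.
apply: (addIr (phi x)); rewrite -PS.
have -> : (- n.+1%:Z + 1 = - n%:Z)%R by lia.
by rewrite IH -[X in (_ + X)%R]mul1r -mulrDl; congr (_ * _)%R; lia.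
Qed.

End SetHomomorphism.

Lemma hom_generated0 (G : groupType) (A : set G) (phi : G -> int) :
  (forall x y, generated A x -> generated A y ->
     phi (x * y) = (phi x + phi y)%R) ->
  (forall x, A x -> phi x = 0%R) -> forall x, generated A x -> phi x = 0%R.
Proof.
move=> phiM phi0; have sH := generated_subgroup A.
suff H : generated A `<=` [set x | generated A x /\ phi x = 0%R].
  by move=> x /H[].
apply: generated_min => [|x Ax]; last by split; [exact: sub_generated|exact: phi0].
split; first by split; [exact: sH.1 | exact: hom_set1 sH phiM].
move=> u v [Hu pu] [Hv pv]; split; first exact: sH.2.
by have := phiM _ _ (sH.2 _ _ Hu Hv) Hv; rewrite mulgVK pu pv addr0.
Qed.

(** The element [x] shows that the subgroup is non-trivial, and a homomorphism onto the integers
    cannot vanish on all generators. *)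
Lemma locally_indicable_hom (K : groupType) (A : set K) (x : K) :
  locally_indicable K -> finite_set A -> generated A x -> x <> 1 ->
  exists phi : K -> int,
    (forall x y, generated A x -> generated A y ->
       phi (x * y) = (phi x + phi y)%R) /\
    exists2 x, A x & phi x != 0%R.
Proof.
move=> LI fA Ax x1.
have [||phi [phiM phi_onto]] := LI _ (generated_subgroup A).
- by exists A.
- by move=> A1; apply: x1; move: Ax; rewrite A1.
have {}phiM y w : generated A y -> generated A w ->
    phi (y * w) = (phi y + phi w)%R.
  by move=> Ay Aw; apply: phiM; exact: mem_set.
exists phi; split=> //; apply: contrapT => phi0.
have : (phi @` generated A) 1%R by rewrite phi_onto.
case=> y Ay; rewrite (hom_generated0 phiM _ Ay) // => w Aw.
by apply: contrapT => /eqP w0; apply: phi0; exists w.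
Qed.

Section Orbit.
Variables (K : groupType) (beta : K -> K).
Hypothesis betaM : {morph beta : x y / x * y}.

Lemma morphg1 : beta 1 = 1.
Proof. by apply: (mulgI (beta 1)); rewrite -betaM !mulg1. Qed.

Lemma iter_morphM n : {morph iter n beta : x y / x * y}.
Proof. by elim: n => // n IH x y; rewrite !iterS IH betaM. Qed.

Lemma morph_expgz x n : beta (expgz x n) = expgz (beta x) n.
Proof.
by apply: (@expgz_hom _ (fun n => beta (expgz x n))) => a b; rewrite expgzD.
Qed.

Definition orbit (z : K) (i : nat) : K := iter i beta z.

Lemma morph_poly_prod z (p : {poly int}) :
  beta (poly_prod (orbit z) p) = poly_prod (orbit z) (p * 'X).
Proof.
rewrite poly_prodMX /poly_prod.
rewrite (big_morph beta betaM morphg1); apply: eq_bigr => i _.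
by rewrite morph_expgz.
Qed.

Lemma iter_poly_prod z (p : {poly int}) n :
  iter n beta (poly_prod (orbit z) p) = poly_prod (orbit z) (p * 'X^n).
Proof.
elim: n => [|n IH]; first by rewrite mulr1.
by rewrite iterS IH morph_poly_prod exprSr mulrA.
Qed.

(** The hypothesis says that [beta] sends the generators of [H] into [H], so [H] is stable under
    [beta]. *)
Lemma orbit_generated z n : generated (orbit z @` `I_n) (orbit z n) ->
  forall i, generated (orbit z @` `I_n) (orbit z i).
Proof.
set H := generated _ => Hn; elim=> [|i IH].
  case: n @H Hn => // n H _; by apply: sub_generated; exists 0%N.
apply: (@morph_generated _ _ beta (orbit z @` `I_n) H betaM _ _ _ IH).
  exact: generated_subgroup.
move=> _ [j jn <-]; rewrite -[beta _]/(orbit z j.+1).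
have [jn'|nj] := ltnP j.+1 n; first by apply: sub_generated; exists j.+1.
by have -> : j.+1 = n by apply/eqP; rewrite eqn_leq nj andbT.
Qed.

(** The component in [K] of a word in [z t^k] (letter [true]) and [t^k] (letter [false]), when
    [beta] is conjugation by [t]; see [prod_orbit_word]. *)
Fixpoint orbit_word (z : K) (k : nat) (s : seq bool) : K :=
  if s is b :: s' then (if b then z else 1) * iter k beta (orbit_word z k s')
  else 1.

Lemma iter_morph1 n : iter n beta 1 = 1.
Proof. by elim: n => // n IH; rewrite iterS IH morphg1. Qed.

Lemma orbit_word_rcons z k s b : orbit_word z k (rcons s b) =
  orbit_word z k s * (if b then orbit z (size s * k) else 1).
Proof.
elim: s => [|c s IH] /=; first by rewrite iter_morph1 mulg1 mul1g.
rewrite IH iter_morphM mulgA; congr (_ * _).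
by case: b {IH} => //; rewrite ?iter_morph1 // /orbit -iterD.
Qed.

Lemma orbit_word_generated z s :
  generated (orbit z @` `I_(size s)) (orbit_word z 1 s).
Proof.
elim/last_ind: s => [|s b IH]; first exact: (generated_subgroup _).1.
rewrite orbit_word_rcons size_rcons; apply: (subgroupM (generated_subgroup _)).
- apply: (generated_min _ _ IH); first exact: generated_subgroup.
  by move=> _ [i /= il <-]; apply: sub_generated; exists i => //=; exact: ltnW.
case: b; last by case: (generated_subgroup (orbit z @` `I_(size s).+1)).
by apply: sub_generated; exists (size s) => //=; rewrite muln1.
Qed.

(** Equal last letters are cancelled. Where the last letters differ, one orbit element is a quotient
    of two words in the earlier ones. *)
Lemma orbit_word_collision z (s1 s2 : seq bool) : size s1 = size s2 ->
  orbit_word z 1 s1 = orbit_word z 1 s2 -> s1 <> s2 ->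
  exists n, generated (orbit z @` `I_n) (orbit z n).
Proof.
elim/last_ind: s1 s2 => [[]//|s1 b1 IH]; elim/last_ind => [|s2 b2 _].
  by rewrite size_rcons.
rewrite !size_rcons !orbit_word_rcons !muln1 => -[sz].
have key (t1 t2 : seq bool) : size t1 = size t2 ->
    orbit_word z 1 t1 * orbit z (size t1) = orbit_word z 1 t2 * 1 ->
    generated (orbit z @` `I_(size t1)) (orbit z (size t1)).
  move=> st e; rewrite -[orbit z _](mulKg (orbit_word z 1 t1)) e mulg1.
  apply: (subgroupM (generated_subgroup _)).
    by apply: (subgroupV (generated_subgroup _)); exact: orbit_word_generated.
  by rewrite st; exact: orbit_word_generated.
case: b1 b2 => -[] e ne.
- apply: (IH s2) => //; [by move: e; rewrite sz => /mulIg|].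
  by move=> s12; apply: ne; rewrite s12.
- by exists (size s1); exact: key e.
- by exists (size s2); apply: key (esym e).
- apply: (IH s2) => //; [by move: e => /mulIg|].
  by move=> s12; apply: ne; rewrite s12.
Qed.

Section Homomorphism.
Variables (z : K) (H : set K) (phi : K -> int).
Hypotheses (sH : subgroup H) (zH : forall i, H (orbit z i)).
Hypothesis phiM : forall x y, H x -> H y -> phi (x * y) = (phi x + phi y)%R.

Lemma hom_set_poly_prod p t : phi (iter t beta (poly_prod (orbit z) p)) =
  shift_sum (fun i => phi (orbit z i)) p t.
Proof.
have sX n s : shift_sum (fun i => phi (orbit z i)) (p * 'X^n) s =
    shift_sum (fun i => phi (orbit z i)) p (n + s)%N.
  elim: n s => [|n IH] s; first by rewrite mulr1.
  by rewrite exprSr mulrA shift_sumMX IH addSnnS.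
rewrite iter_poly_prod -[t in RHS]addn0 -sX /poly_prod /shift_sum.
move: (p * 'X^t)%R => q; move: (size q) => n.
elim: n => [|n IH]; first by rewrite !big_ord0 (hom_set1 sH phiM).
rewrite !big_ord_recr /= phiM ?IH ?(hom_set_expgz sH phiM) ?addn0 //; last first.
  exact: subgroup_expgz.
elim/big_ind: _ => [|x y Hx Hy|i _]; first exact: sH.1.
  exact: subgroupM.
exact: subgroup_expgz.
Qed.

Lemma iter_orbit_word_in k s t : H (iter t beta (orbit_word z k s)).
Proof.
elim: s t => [|b s IH] t /=; first by rewrite iter_morph1; exact: sH.1.
rewrite iter_morphM -iterD; apply: (subgroupM sH) => //.
by case: b; [exact: zH | rewrite iter_morph1; exact: sH.1].
Qed.

Lemma hom_set_orbit_word k s t : phi (iter t beta (orbit_word z k s)) =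
  (\sum_(i < size s) (nth false s i : nat)%:Z * phi (orbit z (i * k + t)))%R.
Proof.
elim: s t => [|b s IH] t /=.
  by rewrite iter_morph1 (hom_set1 sH phiM) big_ord0.
rewrite big_ord_recl /= iter_morphM -iterD phiM; last first.
- exact: iter_orbit_word_in.
- by case: b; [exact: zH | rewrite iter_morph1; exact: sH.1].
rewrite IH mul0n add0n; congr (_ + _)%R.
  by case: b; rewrite ?mul1r // iter_morph1 (hom_set1 sH phiM) mul0r.
apply: eq_bigr => i _; congr (_ * phi (orbit z _))%R.
by rewrite /bump leq0n add1n mulSn; lia.
Qed.

(** The coefficients of [P] are the differences of the letters of the two words, read as 0 or 1. *)
Lemma orbit_word_relation k s1 s2 : size s1 = size s2 ->
  orbit_word z k s1 = orbit_word z k s2 -> s1 <> s2 ->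
  exists P : {poly int}, [/\ P != 0%R, forall i, (`|P`_i| <= 1)%R &
    forall t, shift_sum (fun i => phi (orbit z i)) (P \Po 'X^k) t = 0%R].
Proof.
move=> sz e ne; pose P : {poly int} :=
  (\poly_(i < size s1) ((nth false s1 i : nat)%:Z - (nth false s2 i : nat)%:Z))%R.
exists P; split=> [|i|t].
- apply: contra_not_neq ne => P0; apply: (@eq_from_nth _ false) => // i il.
  have := congr1 (fun p : {poly int} => p`_i)%R P0.
  rewrite coef_poly il coef0; case: (nth _ s1 _); case: (nth _ s2 _) => //.
- rewrite coef_poly; case: ifP => // _.
  by case: (nth _ s1 _); case: (nth _ s2 _).
rewrite shift_sum_comp_Xn.
transitivity (\sum_(i < size s1) P`_i * phi (orbit z (i * k + t)))%R.
  rewrite (big_ord_widen (size s1) (fun i => P`_i * phi (orbit z (i * k + t)))%R).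
    rewrite big_mkcond; apply: eq_bigr => i _; case: ltnP => // Pi.
    by rewrite nth_default // mul0r.
  exact: size_poly.
under eq_bigr do rewrite coef_poly ltn_ord mulrBl.
rewrite sumrB -hom_set_orbit_word sz -hom_set_orbit_word e subrr //.
Qed.

End Homomorphism.

(** Minimality serves twice in [free_semigroup_power]: it excludes a zero constant term, and it is
    contradicted by the cofactor of a cyclotomic factor. *)
Lemma minimal_relation z (c : {poly int}) : c != 0%R ->
  poly_prod (orbit z) c = 1 -> exists c' : {poly int},
  [/\ c' != 0%R, (size c' <= size c)%N, poly_prod (orbit z) c' = 1 &
     forall g : {poly int}, g != 0%R -> (size g < size c')%N ->
       poly_prod (orbit z) g <> 1].
Proof.
have [n] := ubnP (size c); elim: n c => // n IH c szc c0 c1.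
have [min|] := pselect (forall g : {poly int}, g != 0%R ->
  (size g < size c)%N -> poly_prod (orbit z) g <> 1).
  by exists c.
move=> /existsNP[g /not_implyP[g0 /not_implyP[gc /contrapT g1]]].
have [|c' [c'0 c'g c'1 c'min]] := IH g _ g0 g1.
  by rewrite (leq_trans gc).
by exists c'; split=> //; rewrite (leq_trans c'g) // ltnW.
Qed.

Hypothesis beta_free : forall n y, (0 < n)%N -> iter n beta y = y -> y = 1.

(* The orbit of [y = poly_prod g] satisfies the monic recurrence [f], so it
   stays in the abelian group of its first terms, where [f] dividing [X^m - 1]
   forces [beta^m y = y]. *)
Lemma relation_not_cyclotomic z n (f g h : {poly int}) m :
  (forall i j, (i <= n)%N -> (j <= n)%N -> commute (orbit z i) (orbit z j)) ->
  (size (g * f)%R <= n.+1)%N -> f \is monic -> (1 < size f)%N -> (0 < m)%N ->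
  ('X^m - 1 = h * f)%R -> poly_prod (orbit z) (g * f)%R = 1 ->
  poly_prod (orbit z) g = 1.
Proof.
move=> zC szgf fm szf m0 hE gf1.
have [->|g0] := eqVneq g 0%R; first by rewrite /poly_prod size_poly0 big_ord0.
set y := poly_prod (orbit z) g; pose s := (size f).-1.
have sE : size f = s.+1 by rewrite prednK // ltnW.
(* As [s] is the degree of [f], the terms of the orbit of [y] up to index [s] involve only the first
   [n.+1] elements of the orbit of [z], which are known to commute. *)
have szg j : (j <= s)%N -> (size (g * 'X^j)%R <= n.+1)%N.
  move=> js; rewrite (leq_trans _ szgf) // (size_Mmonic g0 fm).
  by rewrite size_mulXn // sE addnS /= addnC leq_add2l.
have zC' i j : (i < n.+1)%N -> (j < n.+1)%N -> commute (orbit z i) (orbit z j).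
  by rewrite !ltnS; exact: zC.
have yE j : orbit y j = poly_prod (orbit z) (g * 'X^j) by exact: iter_poly_prod.
have yC i j : (i <= s)%N -> (j <= s)%N -> commute (orbit y i) (orbit y j).
  by move=> si sj; rewrite !yE; apply: (poly_prod_commute zC'); exact: szg.
have yf1 : poly_prod (orbit y) f = 1.
  rewrite -gf1 -[in RHS](coefK f) poly_def [LHS]/poly_prod mulr_sumr.
  have : (size f <= s.+1)%N by rewrite sE.
  elim: (size f) => [_|k IH ks].
    by rewrite !big_ord0 /poly_prod size_poly0 big_ord0.
  have szk i : (i <= s)%N -> (size (g * (f`_i *: 'X^i))%R <= n.+1)%N.
    by move=> si; rewrite -scalerAr (leq_trans (size_scale_leq _ _)) // szg.
  rewrite !big_ord_recr /= (@poly_prodD _ _ n.+1) //; last first.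
  - exact: szk.
  - rewrite (leq_trans (size_sum _ _ _)) //; apply/bigmax_leqP => i _.
    by apply: szk; rewrite (leq_trans (ltnW (ltn_ord i))).
  rewrite IH ?(ltnW ks) //; congr (_ * _).
  by rewrite -scalerAr (poly_prodZ zC') ?szg // yE.
(* Because [f] is monic, its last factor is [orbit y s] itself, which can be solved for. *)
have ys : generated (orbit y @` `I_s) (orbit y s).
  have := yf1; rewrite (poly_prod_widen _ (n := s.+1)) ?sE // big_ord_recr /=.
  have -> : (f`_s = 1)%R by have := monicP fm; rewrite lead_coefE.
  move=> /mulg1_eq/esym e.
  have -> : orbit y s = (\prod_(i < s) expgz (orbit y i) f`_i)^-1 by exact: e.
  apply: (subgroupV (generated_subgroup _)).
  elim/big_ind: _ => [|a b Ha Hb|i _].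
  - by case: (generated_subgroup (orbit y @` `I_s)).
  - exact: (subgroupM (generated_subgroup _)).
  - apply: (subgroup_expgz _ (generated_subgroup _)).
    by apply: sub_generated; exists i => /=.
(* The entire orbit of [y] now commutes, so the degree bounds disappear from additivity. *)
have yC' i j : commute (orbit y i) (orbit y j).
  apply: (@generated_commute _ (orbit y @` `I_s)); last 2 first.
  - exact: orbit_generated.
  - exact: orbit_generated.
  by move=> _ _ [a /= al <-] [b /= bl <-]; apply: yC; exact: ltnW.
have yD p q : poly_prod (orbit y) (p + q) =
    poly_prod (orbit y) p * poly_prod (orbit y) q.
  apply: (@poly_prodD _ _ (maxn (size p) (size q))) => //.
  - exact: leq_maxl.
  - exact: leq_maxr.
have yZ k p : poly_prod (orbit y) (k *: p)%R = expgz (poly_prod (orbit y) p) k.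
  exact: (@poly_prodZ _ _ (size p)).
have yhf (q : {poly int}) : poly_prod (orbit y) (q * f)%R = 1.
  elim/poly_ind: q => [|q k IH].
    by rewrite mul0r /poly_prod size_poly0 big_ord0.
  rewrite mulrDl yD mulrAC -morph_poly_prod IH morphg1 mul1g mul_polyC yZ yf1.
  by apply/esym/(@expgz_hom _ (fun=> 1)) => *; rewrite mulg1.
apply: (beta_free m0); rewrite -[iter m _ _]/(orbit y m) -poly_prodXn.
have -> : ('X^m = h * f + 1 :> {poly int})%R by rewrite -hE subrK.
by rewrite yD yhf mul1g poly_prod1.
Qed.

End Orbit.

Lemma free_semigroup_power (N : nat) : exists2 l : nat, (0 < l)%N &
  forall (K : groupType) (beta : K -> K) (z : K) (c : {poly int}),
    locally_indicable K -> {morph beta : x y / x * y} -> injective beta ->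
    (forall n y, (0 < n)%N -> iter n beta y = y -> y = 1) ->
    (forall i j, (i <= N)%N -> (j <= N)%N ->
      commute (orbit beta z i) (orbit beta z j)) ->
    c != 0%R -> (size c <= N.+1)%N -> poly_prod (orbit beta z) c = 1 -> z <> 1 ->
  exists2 k : nat, (0 < k <= l)%N & forall s1 s2 : seq bool,
    size s1 = size s2 -> orbit_word beta z k s1 = orbit_word beta z k s2 ->
    s1 = s2.
Proof.
have [l l0 cyc] := cyclotomic_factor N; exists l => //.
move=> K beta z c0 LI bM binj bfree zC c00 szc0 c01 z1.
have [c [cn0 szc c1 cmin]] := minimal_relation c00 c01.
apply: contrapT => noninj.
have coll k : (0 < k <= l)%N -> exists s1 s2 : seq bool, [/\ size s1 = size s2,
    orbit_word beta z k s1 = orbit_word beta z k s2 & s1 <> s2].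
  move=> kl; apply: contrapT => nex; apply: noninj; exists k => // s1 s2 sz e.
  by apply: contrapT => ne; apply: nex; exists s1, s2.
have [s1 [s2 [sz e ne]]] := coll 1%N l0.
have [n zn] := orbit_word_collision bM sz e ne.
set H := generated (orbit beta z @` `I_n) in zn.
have zH := orbit_generated bM zn.
have sH : subgroup H by exact: generated_subgroup.
have [|phi [phiM [_ [i0 _ <-] ai0]]] := locally_indicable_hom LI _ (zH 0%N) z1.
  exact/finite_image/finite_II.
pose a i := phi (orbit beta z i).
have a0 : exists i, a i != 0%R by exists i0.
(* If [c] were [q * 'X], its product would be the image under [beta] of that of [q], and injectivity
   would make [q] a shorter relation. *)
have c_0 : (c`_0 != 0)%R.
  apply/negP => c_0; have /factor_theorem[q] : root c 0%R.
    by rewrite rootE horner_coef0.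
  rewrite subr0 => cE.
  have q0 : q != 0%R by apply: contra_neq cn0 => q0; rewrite cE q0 mul0r.
  apply: (cmin q) => //; first by rewrite cE size_mulX.
  by apply: binj; rewrite (morph_poly_prod bM) -cE c1 morphg1.
have ca t : shift_sum a c t = 0%R.
  rewrite -(hom_set_poly_prod bM sH zH phiM) c1 iter_morph1 //.
  exact: hom_set1 sH phiM.
have [k kl|f [g [h [m [fm szf m0 cE hE]]]]] :=
  cyc a c a0 (leq_trans szc szc0) c_0 ca.
  have [t1 [t2 [szt et nt]]] := coll k kl.
  exact: (orbit_word_relation bM sH zH phiM szt et nt).
have g0 : g != 0%R by apply: contra_neq cn0 => g0; rewrite cE g0 mul0r.
apply: (cmin g) => //.
  rewrite cE size_Mmonic //; case: (size f) szf => [|[|q]] // _.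
  by rewrite !addnS /= ltnS leq_addr.
apply: (relation_not_cyclotomic bM bfree zC _ fm szf m0 hE).
  by rewrite -cE (leq_trans szc).
by rewrite -cE.
Qed.

(** * Word growth *)

Lemma card_fset_set_inj (T U : choiceType) (f : T -> U) (X : set T) (Y : set U) :
  finite_set X -> finite_set Y -> (forall x y, X x -> X y -> f x = f y -> x = y) ->
  (forall x, X x -> Y (f x)) -> (#|` fset_set X| <= #|` fset_set Y|)%N.
Proof.
move=> fX fY finj fXY; have fimX : finite_set (f @` X) by exact: finite_image.
have : (#|` fset_set (f @` X)| <= #|` fset_set Y|)%N.
  apply: fsubset_leq_card; rewrite -fset_set_sub //.
  by move=> _ [x Xx <-]; exact: fXY.
apply: leq_trans; rewrite fset_set_image // card_in_imfset //= => x y.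
by rewrite !in_fset_set // !inE; exact: finj.
Qed.

Section WordBall.
Variable G : groupType.
Implicit Types (A : set G) (x y : G).

Lemma word_ball1 A n : word_ball A n 1.
Proof. by exists [::]; split => //; rewrite big_nil. Qed.

Lemma word_ballM A m n x y : word_ball A m x -> word_ball A n y ->
  word_ball A (m + n) (x * y).
Proof.
move=> [v [vm vA ->]] [w [wn wA ->]]; exists (v ++ w); split.
- by rewrite size_cat leq_add.
- by move=> z; rewrite mem_cat => /orP[/vA|/wA].
- by rewrite big_cat.
Qed.

Lemma word_ball_split A m n x : word_ball A (m + n) x ->
  exists y z, [/\ word_ball A m y, word_ball A n z & x = y * z].
Proof.
move=> [w [wmn wA ->]].
exists (\prod_(y <- take m w) y), (\prod_(y <- drop m w) y); split.
- exists (take m w); split => // [|y /mem_take/wA//].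
  by rewrite size_take_min geq_minl.
- exists (drop m w); split => // [|y /mem_drop/wA//].
  by rewrite size_drop leq_subLR.
- by rewrite -big_cat cat_take_drop.
Qed.

Lemma word_ballV A n x : word_ball A n x -> word_ball A n x^-1.
Proof.
move=> [w [wn wA ->]]; exists (rev [seq y^-1 | y <- w]); split.
- by rewrite size_rev size_map.
- move=> y; rewrite mem_rev => /mapP[z /wA zA ->]; rewrite invgK.
  by case: zA => ?; [right | left].
- by rewrite -map_rev big_map prodgV revK.
Qed.

Lemma word_ball_le A m n x : (m <= n)%N -> word_ball A m x -> word_ball A n x.
Proof.
move=> mn; rewrite -(subnKC mn) -[x in word_ball _ (_ + _) x]mulg1 => Ax.
by apply: word_ballM => //; exact: word_ball1.
Qed.

Lemma word_ball_gen A x : A x -> word_ball A 1 x.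
Proof.
move=> Ax; exists [:: x]; split => //; last by rewrite big_seq1.
by move=> y; rewrite inE => /eqP ->; left.
Qed.

Lemma word_ballX A m n x : word_ball A m x -> word_ball A (n * m) (x ^+ n).
Proof.
move=> Ax; elim: n => [|n IH]; first exact: word_ball1.
by rewrite mulSn expgS; exact: word_ballM.
Qed.

Lemma word_ball_finite A n : finite_set A -> finite_set (word_ball A n).
Proof.
move=> fA; have fA' : finite_set (A `|` (fun x => x^-1) @` A).
  by rewrite finite_setU; split => //; exact: finite_image.
elim: n => [|n IH].
  apply: (@sub_finite_set _ _ [set 1]) => // x [[|y w] [wn _ ->]] //.
  by rewrite /= big_nil.
pose S := [set x * y | x in A `|` (fun x => x^-1) @` A & y in word_ball A n].
apply: (@sub_finite_set _ _ (S `|` [set 1])); last first.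
  by rewrite finite_setU; split => //; exact: finite_image2.
move=> x [[|y w] [wn wA ->]]; first by right; rewrite /= big_nil.
left; exists y.
  by case: (wA y (mem_head _ _)) => Ay; [left | right; exists y^-1; rewrite ?invgK].
exists (\prod_(y <- w) y); last by rewrite big_cons.
by exists w; split => // z zw; apply: wA; rewrite inE zw orbT.
Qed.

Lemma growth_function_gt0 A n : finite_set A -> (0 < growth_function A n)%N.
Proof.
move=> fA; rewrite /growth_function cardfs_gt0; apply/fset0Pn; exists 1.
rewrite in_fset_set ?inE; first exact: word_ball1.
exact: word_ball_finite.
Qed.

Lemma growth_functionD A m n : finite_set A ->
  (growth_function A (m + n) <= growth_function A m * growth_function A n)%N.
Proof.
move=> fA; have fB k := @word_ball_finite A k fA.
rewrite /growth_function -(size_allpairs *%g).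
apply: uniq_leq_size; first exact: fset_uniq.
move=> x; rewrite in_fset_set // inE => /word_ball_split[y [z [Ay Az ->]]].
by apply: allpairs_f; rewrite in_fset_set // inE.
Qed.

End WordBall.

Section GrowthRate.
Variable R : realType.

Lemma growth_rate_ge (G : groupType) (A : set G) (v : R) q : finite_set A ->
  (0 < q)%N -> (0 <= v)%R ->
  (forall n, (0 < n)%N -> (v ^+ n <= (growth_function A (q * n))%:R)%R) ->
  (v `^ (q%:R)^-1 <= growth_rate R A)%R.
Proof.
move=> fA; apply: fekete_lb => *; first exact: growth_function_gt0.
exact: growth_functionD.
Qed.

Lemma growth_rate_le (G : groupType) (A : set G) n : finite_set A ->
  (0 < n)%N -> (growth_rate R A ^+ n <= (growth_function A n)%:R)%R.
Proof.
move=> fA; apply: fekete_ub => *; first exact: growth_function_gt0.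
exact: growth_functionD.
Qed.

Lemma growth_rate_ge0 (G : groupType) (A : set G) : finite_set A ->
  (0 <= growth_rate R A)%R.
Proof.
move=> fA; apply: le_trans (_ : 0%R `^ (1%:R)^-1 <= _)%R.
  exact: powR_ge0.
by apply: growth_rate_ge => // n n0; rewrite expr0n gtn_eqF.
Qed.

Lemma growth_constant_le (G : groupType) (A H : set G) : generating_set H A ->
  (growth_constant R H <= growth_rate R A)%R.
Proof.
move=> HA; apply: ge_inf; last by exists A.
by exists 0%R => _ [B [fB _] <-]; exact: growth_rate_ge0.
Qed.

Lemma growth_constant_ge (G : groupType) (H : set G) (v : R) :
  finitely_generated H ->
  (forall A, generating_set H A -> (v <= growth_rate R A)%R) ->
  (v <= growth_constant R H)%R.
Proof.
move=> [A HA] vle; apply: lb_le_inf; first by exists (growth_rate R A), A.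
by move=> _ [B HB <-]; exact: vle.
Qed.

(** The map [f] embeds the ball of radius [n] for [A] into the ball of radius [q * n] for [B]. *)
Lemma growth_rate_morph (G L : groupType) (f : G -> L) (A : set G) (B : set L)
    q (v : R) : finite_set A -> finite_set B -> {morph f : x y / x * y} ->
  injective f -> (0 < q)%N -> (forall x, A x -> word_ball B q (f x)) ->
  (0 <= v)%R -> (v <= growth_rate R A)%R ->
  (v `^ (q%:R)^-1 <= growth_rate R B)%R.
Proof.
move=> fA fB fM finj q0 fAB v0 vle; apply: growth_rate_ge => // n n0.
apply: le_trans (_ : growth_rate R A ^+ n <= _)%R.
  by rewrite lerXn2r ?nnegrE //; exact: growth_rate_ge0.
apply: le_trans (growth_rate_le fA n0) _; rewrite ler_nat.
apply: (@card_fset_set_inj _ _ f); [exact: word_ball_finite..| |].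
  by move=> x y _ _; exact: finj.
have f1 : f 1 = 1 by apply: (mulgI (f 1)); rewrite -fM !mulg1.
have fV x : f x^-1 = (f x)^-1 by apply/esym/mulg1_eq; rewrite -fM mulgV.
move=> _ [w [wn wA ->]]; apply: (@word_ball_le _ _ (q * size w)).
  by rewrite leq_mul2l wn orbT.
elim: w {wn} wA => [|y w IH] wA; first by rewrite big_nil f1; exact: word_ball1.
rewrite big_cons fM mulnS; apply: word_ballM; last first.
  by apply: IH => z zw; apply: wA; rewrite inE zw orbT.
case: (wA y (mem_head _ _)) => /fAB //; rewrite fV => /word_ballV.
by rewrite invgK.
Qed.

(** The [2 ^ n] positive words of length [n] in [g] and [h] are distinct elements of the ball of
    radius [q * n]. *)
Lemma growth_rate_free_semigroup (G : groupType) (A : set G) q (g h : G) :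
  finite_set A -> (0 < q)%N -> word_ball A q g -> word_ball A q h ->
  (forall s1 s2 : seq bool, size s1 = size s2 ->
    \prod_(b <- s1) (if b then h else g) = \prod_(b <- s2) (if b then h else g) ->
    s1 = s2) ->
  (2 `^ (q%:R)^-1 <= growth_rate R A)%R.
Proof.
move=> fA q0 gA hA inj; apply: growth_rate_ge => // n n0.
rewrite -natrX ler_nat.
pose F (t : n.-tuple bool) := \prod_(b <- t) (if b then h else g).
have -> : (2 ^ n = size [seq F t | t : n.-tuple bool])%N.
  by rewrite size_map -cardE card_tuple card_bool.
apply: uniq_leq_size.
  rewrite map_inj_uniq ?enum_uniq // => t1 t2 e.
  by apply/val_inj/inj => //; rewrite !size_tuple.
move=> _ /mapP[t _ ->]; rewrite in_fset_set ?inE; last exact: word_ball_finite.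
rewrite /F -[n in (q * n)%N](size_tuple t).
elim: (tval t) => [|b s IH]; first by rewrite big_nil; exact: word_ball1.
by rewrite big_cons /= mulnS; apply: word_ballM => //; case: b.
Qed.

End GrowthRate.

(** * Subgroups whose squares come from Z^n *)

(** A matrix with [N.+1] rows and [n] columns has a non-zero rational left kernel vector; clearing
    denominators makes it integral. *)
Lemma int_vectors_dependent (N n : nat) (v : nat -> 'rV[int]_n) : (n <= N)%N ->
  exists c : {poly int}, [/\ c != 0%R, (size c <= N.+1)%N &
    (\sum_(i < N.+1) c`_i *: v i = 0)%R].
Proof.
move=> nN; pose M : 'M[rat]_(N.+1, n) := (\matrix_(i, j) (v i ord0 j)%:~R)%R.
have : (kermx M != 0)%R.
  rewrite kermx_eq0; apply/negP => /eqP rM.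
  by have := rank_leq_col M; rewrite rM leqNgt ltnS nN.
case/matrix0Pn => i [j kij]; pose w := row i (kermx M).
have wM : (w *m M = 0)%R by rewrite -row_mul mulmx_ker row0.
pose p : {poly rat} := (\poly_(l < N.+1) w ord0 (inord l))%R.
have pE (l : 'I_N.+1) : (p`_l = w ord0 l)%R by rewrite coef_poly ltn_ord inord_val.
have [q [a a0 pq]] := rat_poly_scale p.
have aQ : (a%:~R != 0 :> rat)%R by rewrite intr_eq0.
have qE l : ((q`_l)%:~R = a%:~R * p`_l :> rat)%R.
  by rewrite pq coefZ coef_map /= mulVKf.
exists q; split.
- apply: contra_neq kij => q0; have := pE j.
  by rewrite pq q0 rmorph0 scaler0 coef0 mxE => <-.
- apply/leq_sizeP => l Nl; apply: (@intr_inj rat).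
  by rewrite qE coef_poly ltnNge Nl mulr0.
apply/rowP => l; rewrite summxE mxE; apply: (@intr_inj rat).
rewrite rmorph_sum rmorph0 /=.
have : ((w *m M) ord0 l = 0)%R by rewrite wM mxE.
rewrite mxE => /(congr1 (GRing.mul a%:~R)); rewrite mulr0 mulr_sumr; apply: etrans.
by apply: eq_bigr => m _; rewrite mxE [M _ _]mxE intrM qE pE mulrA.
Qed.

(** A homomorphism to the integers that is non-zero at [x] would take twice that value at
    [x * x]. *)
Lemma locally_indicable_sqrt1 (K : groupType) (x : K) : locally_indicable K ->
  x * x = 1 -> x = 1.
Proof.
move=> LI xx; apply: contrapT => x1.
have Hx : generated [set x] x by exact: sub_generated.
have [|phi [phiM [_ /= -> /eqP phix]]] := locally_indicable_hom LI _ Hx x1.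
  exact: finite_set1.
have := phiM _ _ Hx Hx; rewrite xx (hom_set1 (generated_subgroup _) phiM); lia.
Qed.

(** A property shared by the free abelian and the Klein bottle cases, so that both are handled by
    one argument. *)
Definition squares_from_Zn (G : groupType) (n : nat) (H : set G) : Prop :=
  exists psi : 'rV[int]_n -> G,
    (forall v w, psi (v + w)%R = psi v * psi w) /\
    (forall x, H x -> exists v, x * x = psi v).

Lemma set_bij_inverse_morph (G : groupType) (T : Type) (op : T -> T -> T)
    (H : set G) (f : G -> T) : subgroup H ->
  {in H &, {morph f : x y / x * y >-> op x y}} -> set_bij H [set: T] f ->
  exists g : T -> G, (forall s t, g (op s t) = g s * g t) /\
    (forall x, H x -> g (f x) = x).
Proof.
move=> sH fM [_ finj fsurj].
have /choice[g gP] : forall t, exists x, H x /\ f x = t.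
  by move=> t; have [x Hx <-] := fsurj t Logic.I; exists x.
have finj' x y : H x -> H y -> f x = f y -> x = y.
  by move=> Hx Hy; apply: finj; exact: mem_set.
exists g; split=> [s t|x Hx].
  have [[[Hst fst] [Hs fs]] [Ht ft]] := (gP (op s t), gP s, gP t).
  apply: finj' => //; first exact: subgroupM.
  by rewrite fst fM ?mem_set // fs ft.
by have [Hgx fgx] := gP (f x); exact: finj'.
Qed.

Lemma isomorphic_to_Zn_squares (G : groupType) n (H : set G) : subgroup H ->
  isomorphic_to_Zn n H -> squares_from_Zn n H.
Proof.
move=> sH [f [fM fbij]]; have [g [gM gK]] := set_bij_inverse_morph sH fM fbij.
exists g; split=> // x Hx; exists (f (x * x)); rewrite gK //.
exact: subgroupM.
Qed.

Section KleinRelation.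
Variables (G : groupType) (a b : G).
Hypothesis ba : b * a * b^-1 = a^-1.

Lemma klein_conj n : b * expgz a n = expgz a (- n)%R * b.
Proof.
have F_hom := @expgz_hom _ (fun n => b * expgz a n * b^-1).
rewrite -[LHS](mulgVK b) F_hom; last first.
  by move=> k l; rewrite expgzD !mulgA mulgVK.
congr (_ * _); have -> : b * expgz a 1 * b^-1 = expgz a (-1)%R by rewrite /= ba.
apply/esym/(@expgz_hom _ (fun k => expgz a (- k)%R)) => k l.
by rewrite opprD expgzD.
Qed.

Lemma klein_conjV n : b^-1 * expgz a n = expgz a (- n)%R * b^-1.
Proof.
by apply: (mulgI b); rewrite mulVKg mulgA klein_conj opprK mulgK.
Qed.

Lemma klein_conj_exp j n : exists m, expgz b j * expgz a n = expgz a m * expgz b j.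
Proof.
elim: j n => [|j IH|j IH] n; first by exists n; rewrite /= mul1g mulg1.
  have [m e] := IH (- n)%R; exists m.
  have -> : (j.+1%:Z = j%:Z + 1)%R by lia.
  by rewrite expgzS -mulgA klein_conj mulgA e mulgA.
have [m e] := IH (- n)%R; exists m.
have -> : (- j.+1%:Z = - j%:Z + -1)%R by lia.
by rewrite expgzD -mulgA klein_conjV mulgA e mulgA.
Qed.

(** In the Klein bottle group these are the translations, the abelian subgroup generated by [a] and
    [b * b]. *)
Definition klein_translation (v : 'rV[int]_2) : G :=
  expgz a (v ord0 ord0)%R * expgz (b * b) (v ord0 ord_max)%R.

Lemma klein_translationD v w :
  klein_translation (v + w)%R = klein_translation v * klein_translation w.
Proof.
rewrite /klein_translation !mxE !expgzD -!mulgA; congr (_ * _).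
have bba : commute (b * b) a.
  have := klein_conj 1; rewrite -[expgz a 1]/a => ba1.
  have := klein_conj (-1)%R; rewrite opprK -[expgz a 1]/a => ba2.
  by rewrite /commute -mulgA ba1 mulgA ba2 mulgA.
rewrite !mulgA; congr (_ * _); apply/commute_expgz/commute_sym/commute_expgz.
exact: bba.
Qed.

Lemma klein_square i j : exists v,
  (expgz a i * expgz b j) * (expgz a i * expgz b j) = klein_translation v.
Proof.
have [m e] := klein_conj_exp j i.
exists (\row_(l < 2) (if l == ord0 then i + m else j))%R.
rewrite /klein_translation !mxE /=.
rewrite mulgA -[_ * expgz b j * _]mulgA e mulgA -expgzD -mulgA -expgzD.
congr (_ * _); apply/esym.
rewrite -(@expgz_hom _ (fun k => expgz b (k + k)%R)) //.
by move=> k l; rewrite -expgzD; congr expgz; ring.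
Qed.

End KleinRelation.

Lemma klein_bottle_group_squares : squares_from_Zn 2 [set: klein_bottle_group].
Proof.
pose a : klein_bottle_group := pres_class klein_rel [:: (false, false)].
pose b : klein_bottle_group := pres_class klein_rel [:: (true, false)].
have mulE u v : pres_class klein_rel (u ++ v) =
    (pres_class klein_rel u : klein_bottle_group) * pres_class klein_rel v.
  by rewrite -pres_mulE.
have aV : a^-1 = pres_class klein_rel [:: (false, true)].
  apply: mulg1_eq; rewrite -mulE; apply/pres_classP; exact: (pres_cancel _ false false).
have bV : b^-1 = pres_class klein_rel [:: (true, true)].
  apply: mulg1_eq; rewrite -mulE; apply/pres_classP; exact: (pres_cancel _ true false).
have ba : b * a * b^-1 = a^-1.
  rewrite aV bV /a /b -!mulE; apply/pres_classP; apply: pres_rel; exact: KleinRel.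
exists (klein_translation a b); split; first exact: klein_translationD.
(* Normal form, by induction on a word: a new letter [b] or its inverse on the left passes the power
   of [a] by reversing its exponent. *)
move=> x _; suff [i [j ->]] : exists i j, x = expgz a i * expgz b j.
  exact: klein_square.
rewrite -(pres_reprK x); elim: (repr x) => [|[c e] w [i [j IH]]].
  by exists 0%R, 0%R; rewrite /= mul1g.
rewrite -cat1s mulE IH; case: c; case: e.
- rewrite -bV mulgA (klein_conjV ba) -mulgA.
  by exists (- i)%R, (-1 + j)%R; rewrite expgzD.
- rewrite -/b mulgA (klein_conj ba) -mulgA.
  by exists (- i)%R, (1 + j)%R; rewrite expgzD.
- by exists (-1 + i)%R, j; rewrite -aV expgzD mulgA.
- by exists (1 + i)%R, j; rewrite expgzD mulgA.
Qed.

Lemma isomorphic_to_klein_squares (G : groupType) (H : set G) : subgroup H ->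
  isomorphic_to klein_bottle_group H -> squares_from_Zn 2 H.
Proof.
move=> sH [f [fM fbij]]; have [g [gM gK]] := set_bij_inverse_morph sH fM fbij.
have [psi [psiM psiP]] := klein_bottle_group_squares.
exists (g \o psi); split=> [v w|x Hx] /=; first by rewrite psiM gM.
have [v fx] := psiP (f x) Logic.I; exists v.
by rewrite -fx gM gK.
Qed.

Lemma squares_relation (G : groupType) N n (H : set G) (z : nat -> G) :
  (n <= N)%N -> squares_from_Zn n H ->
  (forall i, (i <= N)%N -> exists2 x, H x & z i = x * x) ->
  (forall i j, (i <= N)%N -> (j <= N)%N -> commute (z i) (z j)) /\
  exists c : {poly int}, [/\ c != 0%R, (size c <= N.+1)%N & poly_prod z c = 1].
Proof.
move=> nN [psi [psiD psiP]] zH.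
have /choice[v vP] : forall i, exists v, (i <= N)%N -> z i = psi v.
  move=> i; have [iN|] := leqP i N; last by exists 0%R.
  by have [x /psiP[v xv] zx] := zH i iN; exists v => _; rewrite zx.
split=> [i j iN jN|].
  by rewrite /commute !vP // -!psiD addrC.
have [c [c0 szc cv]] := int_vectors_dependent v nN.
exists c; split=> //; rewrite (poly_prod_widen _ szc).
have psi0 : psi 0%R = 1 by apply: (mulgI (psi 0%R)); rewrite -psiD mulg1 addr0.
rewrite -[RHS]psi0 -[in RHS]cv (big_morph psi psiD psi0); apply: eq_bigr => i _.
rewrite vP -1?ltnS //; apply/esym.
rewrite (@expgz_hom _ (fun k => psi (k *: v i)%R)) ?scale1r // => k l.
by rewrite scalerDl psiD.
Qed.

(** * The extension *)

Section Extension.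
Variables (K : groupType) (alpha : automorphism K).
Local Notation G := (hnn_extension alpha).
Local Notation base := (@hnn_base K alpha).

Lemma hnn_baseM : {morph base : x y / x * y}.
Proof. by move=> x y. Qed.

Lemma hnn_base_inj : injective base.
Proof. by move=> x y [->]. Qed.

Lemma hnn_height0 (g : G) : g.2 = 0%R -> g = base g.1.
Proof. by case: g => x m /= ->. Qed.

Lemma hnn_heightM (g h : G) : (g * h).2 = (g.2 + h.2)%R.
Proof. by []. Qed.

Lemma hnn_heightV (g : G) : (g^-1).2 = (- g.2)%R.
Proof. by []. Qed.

Lemma hnn_heightX (g : G) n : (g ^+ n).2 = (g.2 *+ n)%R.
Proof.
by elim: n => // n IH; rewrite expgS hnn_heightM IH mulrS.
Qed.

Lemma aut_expK m : cancel (aut_exp alpha m) (aut_exp alpha (- m)%R).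
Proof. by move=> x; rewrite -aut_expD addNr. Qed.

Definition hnn_conj (t : G) (y : K) : K := t.1 * aut_exp alpha t.2 y * t.1^-1.

Lemma hnn_conjE (t : G) y : t * base y = base (hnn_conj t y) * t.
Proof.
case: t => k m; rewrite -[LHS]/(hnn_mul _ _) -[RHS]/(hnn_mul _ _).
by rewrite /hnn_mul /hnn_conj /= mulgVK addr0 add0r.
Qed.

Lemma hnn_conjM (t : G) : {morph hnn_conj t : x y / x * y}.
Proof. by move=> x y; rewrite /hnn_conj aut_expM !mulgA mulgVK. Qed.

Lemma hnn_conj_inj (t : G) : injective (hnn_conj t).
Proof. by move=> x y /mulIg/mulgI/(can_inj (aut_expK _)). Qed.

Lemma iter_hnn_conjE (t : G) n y :
  t ^+ n * base y = base (iter n (hnn_conj t) y) * t ^+ n.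
Proof.
elim: n => [|n IH]; first by rewrite /= mul1g mulg1.
by rewrite expgS -mulgA IH mulgA hnn_conjE -mulgA.
Qed.

(** The [n]-th iterate is a power of [alpha] with exponent the height of [t ^+ n], which is
    non-zero, followed by a conjugation in [K]; a non-trivial fixed point would give a periodic
    conjugacy class. *)
Lemma iter_hnn_conj_free (t : G) n y : ~ has_periodic_conjugacy_class alpha ->
  t.2 <> 0%R -> (0 < n)%N -> iter n (hnn_conj t) y = y -> y = 1.
Proof.
move=> nper t0 n0 e; apply: contrapT => y1; apply: nper.
exists y, (t ^+ n).2; split => //.
  by move/eqP; rewrite hnn_heightX mulrn_eq0 -leqn0 leqNgt n0 /=; exact/negP/eqP.
exists (t ^+ n).1; rewrite conjgE; apply: (mulgI (t ^+ n).1); rewrite mulVKg.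
by have := congr1 fst (iter_hnn_conjE t n y); rewrite e.
Qed.

Lemma hnn_finitely_generated : finitely_generated [set: K] ->
  finitely_generated [set: G].
Proof.
move=> [B [fB gB]]; pose t : G := hnn_stable alpha.
exists (base @` B `|` [set t]); split.
  by rewrite finite_setU; split; [exact: finite_image | exact: finite_set1].
apply/seteqP; split=> // -[k m] _; set H := generated _.
have sH : subgroup H by exact: generated_subgroup.
have -> : (k, m) = base k * ((1, m) : G).
  rewrite -[RHS]/(hnn_mul _ _).
  by rewrite /hnn_mul /= mulg1 add0r.
apply: (subgroupM sH).
  apply: (@morph_generated _ _ base B H hnn_baseM sH) => [x Bx|].
    by apply: sub_generated; left; exists x.
  by rewrite gB.
rewrite (@expgz_hom G (fun m => (1, m) : G)) => [|i j].
  by apply: (subgroup_expgz _ sH); apply: sub_generated; right.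
by rewrite -[RHS]/(hnn_mul _ _) /hnn_mul /= aut_exp1 mulg1.
Qed.

(** All powers of [t] are moved to the right. Words of equal length carry the same power, so
    comparing them reduces to comparing their [orbit_word]s. *)
Lemma prod_orbit_word (t : G) (z : K) k (s : seq bool) :
  \prod_(b <- s) (if b then base z * t ^+ k else t ^+ k) =
  base (orbit_word (hnn_conj t) z k s) * t ^+ (k * size s).
Proof.
elim: s => [|b s IH]; first by rewrite big_nil muln0 mulg1.
rewrite big_cons {}IH /= mulnS expgnDr.
set w := orbit_word _ _ _ _; set T := t ^+ (k * size s).
have e : t ^+ k * (base w * T) = base (iter k (hnn_conj t) w) * (t ^+ k * T).
  by rewrite !mulgA iter_hnn_conjE.
by case: b; rewrite ?hnn_baseM ?mul1g // -!mulgA e.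
Qed.

Variable A : set G.
Hypothesis gA : generated A = [set: G].

Lemma generating_set_height : exists2 t, A t & t.2 <> 0%R.
Proof.
apply: contrapT => nt.
have : generated A `<=` [set g : G | g.2 = 0%R].
  apply: generated_min => [|g Ag].
    split=> // g h g0 h0; rewrite /mkset hnn_heightM hnn_heightV.
    by rewrite (g0 : g.2 = 0%R) (h0 : h.2 = 0%R).
  by apply: contrapT => g0; apply: nt; exists g.
by rewrite gA => /(_ (hnn_stable alpha) Logic.I).
Qed.

(** Otherwise [t] would be central and conjugation by [t] would fix every element of [K], against
    [iter_hnn_conj_free] with exponent 1. *)
Lemma generating_set_noncentral (t : G) : [set: K] <> [set 1] ->
  ~ has_periodic_conjugacy_class alpha -> t.2 <> 0%R ->
  exists2 a, A a & [~ a, t] <> 1.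
Proof.
move=> K1 nper t0; apply: contrapT => na; apply: K1.
apply/seteqP; split=> // y _ /=.
have tC g : commute t g.
  have : generated A g by rewrite gA.
  apply: (@generated_min _ A [set g | commute t g]) => [|a Aa].
    split=> [|u v /= tu tv]; first exact: commute1.
    exact/commuteM/commuteV.
  apply/commute_sym; have /eqP/commgP : [~ a, t] = 1 => //.
  by apply: contrapT => at1; apply: na; exists a.
apply: (@iter_hnn_conj_free t 1) => //=.
by apply/hnn_base_inj/(mulIg t); rewrite -hnn_conjE; exact: tC.
Qed.

End Extension.

Local Close Scope group_scope.
Local Open Scope ring_scope.

(** * Assembling the uniform lower bound on growth *)

Theorem theorem6p1 (R : realType) (u : R) (d : nat) (hu : 1 < u)
    (hd : (0 < d)%N) :
  exists2 k : R, 1 < k &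
    forall K : groupType,
      [set: K] <> [set 1%g] ->
      finitely_generated [set: K] ->
      locally_indicable K ->
      (forall H : set K, subgroup H -> finitely_generated H ->
        [\/ u <= growth_constant R H,
            exists2 n : nat, (n <= d)%N & isomorphic_to_Zn n H
          | isomorphic_to klein_bottle_group H]) ->
    forall alpha : automorphism K,
      ~ has_periodic_conjugacy_class alpha ->
      k <= growth_constant R [set: hnn_extension alpha].
Proof.
(* [N] is at least both [d] and the rank 2 of the Klein bottle case. *)
pose N := d.+2; have [l l0 power] := free_semigroup_power N.
(* The commutator [x] has length at most 4. Thus [q1] bounds the length of [x^2 t^k] for [k] up to
   [l], and [q2] that of [t^i x t^-i] for [i] up to [N]. *)
pose q1 := (l + 8)%N; pose q2 := (N * 2 + 4)%N.
exists (Num.min (2 `^ (q1%:R)^-1)%R (u `^ (q2%:R)^-1)%R).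
  have root_gt1 (v : R) q : (1 < v)%R -> (0 < q)%N -> (1 < v `^ (q%:R)^-1)%R.
    move=> v1 q0; have e : (1 `^ (q%:R)^-1)%R = 1%R :> R by rewrite powR1.
    rewrite -[X in (X < _)%R]e.
    apply: gt0_ltr_powR => //; rewrite ?nnegrE ?invr_gt0 ?ltr0n //.
    by rewrite (le_trans ler01) // ltW.
  by rewrite lt_min !root_gt1 ?ltr1n ?addn_gt0 ?orbT.
move=> K K1 Kfg LI trich alpha nper.
apply: growth_constant_ge => [|A [fA gA]]; first exact: hnn_finitely_generated.
have [t At t0] := generating_set_height gA.
have [a Aa at1] := generating_set_noncentral gA K1 nper t0.
set beta := hnn_conj t.
have betaM : {morph beta : x y / (x * y)%g} := hnn_conjM t.
have at0 : [~ a, t]%g.2 = 0%R.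
  by rewrite commgEl conjgE !hnn_heightM !hnn_heightV; lia.
pose x := [~ a, t]%g.1.
have xE : hnn_base alpha x = [~ a, t]%g by rewrite (hnn_height0 at0).
have x1 : x <> 1%g by move=> x1; apply: at1; rewrite -xE x1.
have ball_t n : word_ball A n (t ^+ n)%g.
  by rewrite -[n in word_ball _ n]muln1; apply: word_ballX; exact: word_ball_gen.
have ball_x : word_ball A 4 (hnn_base alpha x).
  rewrite xE commgEl conjgE.
  apply: (@word_ballM _ _ 1 3); first exact/word_ballV/word_ball_gen.
  apply: (@word_ballM _ _ 1 2); first exact/word_ballV/word_ball_gen.
  by apply: (@word_ballM _ _ 1 1); exact: word_ball_gen.
(* The indices 0 to [N] give [N.+1] elements, one more than the largest rank allowed, which forces a
   relation between their squares. *)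
pose B := orbit beta x @` `I_N.+1.
have fB : finite_set B by exact/finite_image/finite_II.
have ball_B y : B y -> word_ball A q2 (hnn_base alpha y).
  move=> [i /= iN <-].
  have -> : hnn_base alpha (orbit beta x i) =
      (t ^+ i * hnn_base alpha x * (t ^+ i)^-1)%g.
    by rewrite iter_hnn_conjE mulgK.
  apply: (@word_ball_le _ _ (i + 4 + i)); first by rewrite /q2; lia.
  by apply: word_ballM; [exact: word_ballM | exact: word_ballV].
pose H := generated B; have sH : subgroup H by exact: generated_subgroup.
have genH : generating_set H B by [].
have squares : (u <= growth_constant R H)%R \/
    exists2 n, (n <= N)%N & squares_from_Zn n H.
  have [|ge_u|[n nd Zn]|klein] := trich H sH; first by exists B.
  - by left.
  - right; exists n; last exact: isomorphic_to_Zn_squares.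
    by rewrite (leq_trans nd) // /N; lia.
  - by right; exists 2%N; [|exact: isomorphic_to_klein_squares].
case: squares => [ge_u|[n nN sq]]; rewrite ge_min; apply/orP; [right|left].
  apply: (growth_rate_morph fB fA (@hnn_baseM K alpha)) => //.
  - exact: hnn_base_inj.
  - by rewrite (le_trans ler01) // ltW.
  - exact: le_trans ge_u (growth_constant_le R genH).
pose z := (x * x)%g.
have zE i : orbit beta z i = (orbit beta x i * orbit beta x i)%g.
  exact: iter_morphM.
have [zC [c [c0 szc c1]]] : (forall i j, (i <= N)%N -> (j <= N)%N ->
      commute (orbit beta z i) (orbit beta z j)) /\
    exists c : {poly int}, [/\ c != 0%R, (size c <= N.+1)%N &
      poly_prod (orbit beta z) c = 1%g].
  apply: (squares_relation nN sq) => i iN; exists (orbit beta x i) => //.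
  by apply: sub_generated; exists i.
have z1 : z <> 1%g by move=> /(locally_indicable_sqrt1 LI).
have [||k /andP[k0 kl] inj] := power K beta z c LI betaM _ _ zC c0 szc c1 z1.
- exact: hnn_conj_inj.
- by move=> m y; exact: iter_hnn_conj_free.
apply: (@growth_rate_free_semigroup _ _ _ _ (t ^+ k)%g
  (hnn_base alpha z * t ^+ k)%g) => //.
- by rewrite addn_gt0 orbT.
- by apply: word_ball_le (ball_t k); rewrite /q1; lia.
- apply: (@word_ball_le _ _ (4 + 4 + k)); first by rewrite /q1; lia.
  by apply: word_ballM => //; rewrite hnn_baseM; exact: word_ballM.
move=> s1 s2 sz; rewrite !prod_orbit_word sz => /mulIg/hnn_base_inj.
exact: inj.
Qed.
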